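(* Let $(E,C)$ be a finite bipartite separated graph satisfying condition (L). Then the C*-algebra $\mathcal O^r(E,C)$ satisfies property (SP). More precisely, given a nonzero positive element $c$ in $\mathcal O^r(E,C)$, there is an element $x\in\mathcal O^r(E,C)$ such that $x^*cx$ is a nonzero projection in $C(\Omega(E,C))$. In particular every nonzero ideal of $\mathcal O^r(E,C)$ contains a nonzero projection of $C(\Omega(E,C))$.
   Context: A separated graph is a pair $(E,C)$, where $E=(E^0,E^1,r,s)$ is a directed graph and $C=\bigsqcup_{v\in E^0}C_v$ with $C_v$ a partition of $r^{-1}(v)$ into nonempty subsets ($C_v=\emptyset$ if $r^{-1}(v)=\emptyset$). It is finite if $E^0,E^1$ are finite, and bipartite if $E^0=E^{0,0}\sqcup E^{0,1}$ with all arrows going from $E^{0,1}$ to $E^{0,0}$, $r(E^1)=E^{0,0}$ and $s(E^1)=E^{0,1}$. For $e\in E^1$, $X_e$ is the unique element of $C$ containing $e$. $\mathbb F$ is the free group on $E^1$. An $(E,C)$-dynamical system is a compact Hausdorff space $\Omega$ with clopen subsets $\Omega_v$ ($v\in E^0$) with $\Omega=\bigsqcup_{v\in E^0}\Omega_v$, for each $v\in E^{0,0}$ clopen subsets $H_x\subseteq\Omega_v$ ($x\in r^{-1}(v)$) with $\Omega_v=\bigsqcup_{x\in X}H_x$ for all $X\in C_v$, and homeomorphisms $\theta_x\colon\Omega_{s(x)}\to H_x$ for all $x\in E^1$. A map $f$ between such systems is equivariant if $f(\Omega_w)\subseteq\Omega'_w$ ($w\in E^0$), $f(H_x)\subseteq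 H'_x$ and $f\circ\theta_x=\theta'_x\circ f$ on $\Omega_{s(x)}$ ($x\in E^1$). $\Omega(E,C)$ is the universal $(E,C)$-dynamical system: the one to which every $(E,C)$-dynamical system admits a unique continuous equivariant map; it exists, is unique up to isomorphism, and is a zero-dimensional metrizable compact space. The canonical partial action of $\mathbb F$ on it: for a reduced word $g=g_1\cdots g_k$ in letters $x^{\pm1}$, $\theta_g=\theta_{g_1}\circ\cdots\circ\theta_{g_k}$ (composition of partial homeomorphisms on the largest possible domain, $\theta_{x^{-1}}=\theta_x^{-1}$), $\theta_g\colon U_{g^{-1}}\to U_g$ with all $U_g$ clopen. The induced partial action $\alpha$ on $C(\Omega(E,C))$: $\mathcal D_g=1_{U_g}C(\Omega(E,C))$, $\alpha_g\colon\mathcal D_{g^{-1}}\to\mathcal D_g$, $\alpha_g(f)=f\circ\theta_{g^{-1}}$ on $U_g$, zero elsewhere. $\mathcal O^r(E,C)=C(\Omega(E,C))\rtimes^r_\alpha\mathbb F$ is the reduced crossed product C*-algebra of this partial action: the completion of the $*$-algebra of finite sums $\sum_ga_g\delta_g$, $a_g\in\mathcal D_g$ (product $(a_g\delta_g)(b_h\delta_h)=\alpha_g(\alpha_{g^{-1}}(a_g)b_h)\delta_{gh}$, involution $(a_g\delta_g)^*=\alpha_{g^{-1}}(a_g^* )\delta_{g^{-1}}$) in the C*-norm for which $\sum a_g\delta_g\mapsto a_1$ extends to a faithful conditional expectation onto $C(\Omega(E,C))$ (identified with $C(\Omega(E,C))\delta_1$). A C*-algebra has property (SP) if every nonzero hereditary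 C*-subalgebra contains a nonzero projection. Condition (L). Paths are taken in the double $\hat E$ of $E$, obtained by adding for each $e\in E^1$ an edge $e^*$ with $s(e^* )=r(e)$, $r(e^* )=s(e)$; paths are written right to left. A path $e_{2r}^*e_{2r-1}\cdots e_4^*e_3e_2^*e_1$ is admissible if $X_{e_{2i-1}}\ne X_{e_{2i}}$ for $i=1,\dots,r$ and $e_{2i+1}\ne e_{2i}$ for $i=1,\dots,r-1$; the same definition applies to paths $e_{2r-1}\cdots e_4^*e_3e_2^*e_1$. A closed path in $(E,C)$ is a non-trivial admissible path $\gamma=e_{2r}^*e_{2r-1}\cdots e_2^*e_1$ with $s(e_1)=s(e_{2r})$. A cycle is a closed path such that $e_1\neq e_{2r}$ and $s(e_{2i-1})\ne s(e_{2j})$ for all $1\le i\le j<r$. An entry of a closed path $\gamma$ is a non-trivial admissible path $x_{2t-1}x_{2t-2}^*\cdots x_3x_2^*x_1$ such that $s(x_1)=s(e_1)$ and $|X|\ge2$ for some $X\in C_{r(x_{2t-1})}$ with $X\ne X_{x_{2t-1}}$. $(E,C)$ satisfies condition (L) if every cycle has an entry. *)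

(* Defs.v *)
From HB Require Import structures.
From mathcomp Require Import all_boot all_order all_algebra.
From mathcomp Require Import all_classical all_reals all_analysis.
From mathcomp Require Import complex.

Set Implicit Arguments.
Unset Strict Implicit.
Unset Printing Implicit Defensive.

Import Order.TTheory GRing.Theory Num.Theory numFieldNormedType.Exports.

Local Open Scope classical_set_scope.
Local Open Scope ring_scope.

Section FreeGroup.
Variable X : choiceType.

(* The letter [(x, false)] is x and the letter [(x, true)] is its inverse. *)
Definition letter : Type := (X * bool)%type.
Definition linv (a : letter) : letter := (a.1, ~~ a.2).

Lemma linvK : involutive linv.
Proof. by case=> x b; rewrite /linv /= negbK. Qed.

Lemma linv_neq (a : letter) : linv a != a.
Proof. by case: a => x []; rewrite /linv /= xpair_eqE andbF. Qed.

Definition reduced (w : seq letter) : bool :=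
  sorted (fun a b : letter => b != linv a) w.

Record freeGroup : Type := FreeGroup {
  fgword :> seq letter;
  fgwordP : reduced fgword
}.

HB.instance Definition _ := [isSub for fgword].
HB.instance Definition _ := [Choice of freeGroup by <:].

(* Left multiplication of a reduced word by a letter, with cancellation. *)
Definition lcons (a : letter) (w : seq letter) : seq letter :=
  if w is b :: w' then if b == linv a then w' else a :: w else [:: a].

Lemma reduced_lcons a w : reduced w -> reduced (lcons a w).
Proof.
case: w => [//|b w] /= hw; case: ifPn => [_|hb]; first exact: path_sorted hw.
by rewrite /reduced /= hb.
Qed.

Definition lmul (u v : seq letter) : seq letter := foldr lcons v u.

Lemma reduced_lmul u v : reduced v -> reduced (lmul u v).
Proof. by move=> hv; elim: u => [//|a u IH]; apply: reduced_lcons. Qed.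

Lemma lconsK a w : reduced w -> lcons a (lcons (linv a) w) = w.
Proof.
case: w => [|b w] /=; first by rewrite eqxx.
rewrite linvK; case: (eqVneq b a) => [->|_ _]; last by rewrite /= eqxx.
case: w => [//|c w]; rewrite /reduced /= => /andP[hc _].
by rewrite (negbTE hc).
Qed.

Lemma lmul_lcons a u w : reduced u -> reduced w ->
  lmul (lcons a u) w = lcons a (lmul u w).
Proof.
case: u => [//|b u] /= hu hw; case: ifPn => [/eqP ->|//].
by rewrite lconsK // reduced_lmul.
Qed.

Lemma lmulA u v w : reduced v -> reduced w ->
  lmul u (lmul v w) = lmul (lmul u v) w.
Proof.
move=> hv hw; elim: u => [//|a u IH] /=.
by rewrite IH lmul_lcons // reduced_lmul.
Qed.

Lemma lmulw1 w : reduced w -> lmul w [::] = w.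
Proof.
elim: w => [//|a w IH] hw /=; rewrite IH; last exact: path_sorted hw.
by case: w hw {IH} => [//|b w]; rewrite /reduced /= => /andP[/negbTE ->].
Qed.

Definition winv (w : seq letter) : seq letter := rev (map linv w).

Lemma reduced_winv w : reduced w -> reduced (winv w).
Proof.
rewrite /reduced /winv rev_sorted sorted_map; apply: sub_sorted => a b /=.
by rewrite linvK eq_sym.
Qed.

Lemma winvK : involutive winv.
Proof. by move=> w; rewrite /winv map_rev revK mapK //; exact: linvK. Qed.

Lemma lmulVw w : reduced w -> lmul (winv w) w = [::].
Proof.
rewrite -{1}(cats0 w) /winv /lmul => hw.
suff H u v : reduced (u ++ v) -> foldr lcons (u ++ v) (rev (map linv u)) = v.
  by rewrite -{1}(cats0 w) H.
elim: u => [//|a u IH] /= h; rewrite rev_cons foldr_rcons /= linvK eqxx.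
by apply: IH; exact: path_sorted h.
Qed.

Definition fg1 : freeGroup := @FreeGroup [::] isT.
Definition fgM (g h : freeGroup) : freeGroup :=
  FreeGroup (reduced_lmul g (fgwordP h)).
Definition fgV (g : freeGroup) : freeGroup :=
  FreeGroup (reduced_winv (fgwordP g)).

Lemma fgMA : associative fgM.
Proof. by move=> g h k; apply: val_inj; apply: lmulA; apply: fgwordP. Qed.
Lemma fg1M : left_id fg1 fgM.
Proof. by move=> g; apply: val_inj. Qed.
Lemma fgM1 : right_id fg1 fgM.
Proof. by move=> g; apply: val_inj; apply: lmulw1; apply: fgwordP. Qed.
Lemma fgVM : left_inverse fg1 fgV fgM.
Proof. by move=> g; apply: val_inj; apply: lmulVw; apply: fgwordP. Qed.
Lemma fgMV : right_inverse fg1 fgV fgM.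
Proof.
move=> g; rewrite -{1}[g](_ : fgV (fgV g) = g) ?fgVM //.
by apply: val_inj; apply: winvK.
Qed.

HB.instance Definition _ :=
  isGroup.Build freeGroup fgMA fg1M fgM1 fgVM fgMV.

End FreeGroup.

Record sepgraph : Type := SepGraph {
  vert : finType;
  edge : finType;
  src : edge -> vert;
  rng : edge -> vert;
  sep : vert -> {set {set edge}};
  sepP : forall v, finset.partition (sep v) [set e | rng e == v]%SET
}.

(* [V0] is E^{0,0} and its complement is E^{0,1}. *)
Definition bipartite (G : sepgraph) : Prop :=
  exists V0 : {set vert G},
    [set rng e | e : edge G]%SET = V0 /\ [set src e | e : edge G]%SET = (~: V0)%SET.

(* X_e, the member of the separation containing e. *)
Definition eclass (G : sepgraph) (e : edge G) : {set edge G} :=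
  finset.pblock (sep (rng e)) e.

(* [admissible m e] : the sequence e 1, ..., e m of edges of E spells an
   admissible path  ... (e 4)^* (e 3) (e 2)^* (e 1)  of length m in the double
   of E: odd indices are edges of E and even indices are starred edges.  Values
   of e outside 1, ..., m are irrelevant.  The equalities of vertices say that
   consecutive edges are composable in the double, where s(f^* ) = r(f) and
   r(f^* ) = s(f). *)
Definition admissible (G : sepgraph) (m : nat) (e : nat -> edge G) : Prop :=
  (forall i, (0 < i)%N -> (i.*2 <= m)%N ->
     rng (e i.*2.-1) = rng (e i.*2) /\ eclass (e i.*2.-1) <> eclass (e i.*2)) /\
  (forall i, (0 < i)%N -> (i.*2.+1 <= m)%N ->
     src (e i.*2) = src (e i.*2.+1) /\ e i.*2.+1 <> e i.*2).

Definition closed_path (G : sepgraph) (k : nat) (e : nat -> edge G) : Prop :=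
  [/\ (0 < k)%N, admissible k.*2 e & src (e 1%N) = src (e k.*2)].

Definition is_cycle (G : sepgraph) (k : nat) (e : nat -> edge G) : Prop :=
  [/\ closed_path k e,
      e 1%N <> e k.*2
    & forall i j, (0 < i)%N -> (i <= j)%N -> (j < k)%N ->
        src (e i.*2.-1) <> src (e j.*2)].

(* [x] is an entry of length 2t-1 of a closed path with first edge [e1]. *)
Definition is_entry (G : sepgraph) (e1 : edge G) (t : nat)
    (x : nat -> edge G) : Prop :=
  [/\ (0 < t)%N, admissible t.*2.-1 x, src (x 1%N) = src e1
    & exists X : {set edge G},
        [/\ X \in sep (rng (x t.*2.-1)), (2 <= #|X|)%N
          & X <> eclass (x t.*2.-1)]].

Definition condition_L (G : sepgraph) : Prop :=
  forall (k : nat) (e : nat -> edge G), is_cycle k e ->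
    exists (t : nat) (x : nat -> edge G), is_entry (e 1%N) t x.

(* f restricts to a homeomorphism from A onto B, with inverse the restriction
   of g; the values of f off A and of g off B are irrelevant. *)
Definition homeo_on (T : topologicalType) (A B : set T) (f g : T -> T) : Prop :=
  [/\ f @` A `<=` B, g @` B `<=` A,
      (forall t, A t -> g (f t) = t), (forall t, B t -> f (g t) = t)
    & {within A, continuous f} /\ {within B, continuous g}].

Record dynsys (G : sepgraph) : Type := DynSys {
  dspace :> topologicalType;
  ds_compact : compact [set: dspace];
  ds_hausdorff : hausdorff_space dspace;
  dvert : vert G -> set dspace;
  dvert_clopen : forall v, clopen (dvert v);
  dvert_cover : \bigcup_v dvert v = [set: dspace];
  dvert_disj : trivIset setT dvert;
  dedge : edge G -> set dspace;
  dedge_clopen : forall x, clopen (dedge x);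
  dedge_sub : forall x, dedge x `<=` dvert (rng x);
  dedge_cover : forall v (X : {set edge G}), X \in sep v ->
    \bigcup_(x in [set` X]) dedge x = dvert v;
  dedge_disj : forall v (X : {set edge G}), X \in sep v ->
    trivIset [set` X] dedge;
  dtheta : edge G -> dspace -> dspace;
  dthetaV : edge G -> dspace -> dspace;
  dthetaP : forall x,
    homeo_on (dvert (src x)) (dedge x) (dtheta x) (dthetaV x)
}.

Arguments dvert {G} d v _.
Arguments dedge {G} d x _.
Arguments dtheta {G} d x _.
Arguments dthetaV {G} d x _.

Definition equivariant (G : sepgraph) (S S' : dynsys G) (f : S -> S') : Prop :=
  [/\ (forall w, f @` dvert S w `<=` dvert S' w),
      (forall x, f @` dedge S x `<=` dedge S' x)
    & (forall x t, dvert S (src x) t ->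
         f (dtheta S x t) = dtheta S' x (f t))].

Definition universal (G : sepgraph) (S : dynsys G) : Prop :=
  forall S' : dynsys G, exists! f : S' -> S, continuous f /\ equivariant f.

Section PartialAction.
Variables (G : sepgraph) (S : dynsys G).

(* Partial maps are encoded as functions into [option]. *)
Definition theta_letter (a : letter (edge G)) (t : S) : option S :=
  if a.2 then
    if `[< dedge S a.1 t >] then Some (dthetaV S a.1 t) else None
  else
    if `[< dvert S (src a.1) t >] then Some (dtheta S a.1 t) else None.

Definition theta (g : freeGroup (edge G)) (t : S) : option S :=
  foldr (fun a o => obind (theta_letter a) o) (Some t) (fgword g).

(* U_g, the range of theta_g. *)
Definition Uset (g : freeGroup (edge G)) : set S :=
  [set t | exists t', theta g t' = Some t].

End PartialAction.

Definition Cplx (R : realType) : numClosedFieldType := R[i].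

(* Complex C*-algebras, not assumed unital.  The product is part of the mixin
   because Hierarchy Builder cannot join normed modules with rings that are not
   numDomainTypes. *)
HB.mixin Record isCStarAlgebra (R : realType) A
    of CompleteNormedModule (Cplx R) A := {
  cmul : A -> A -> A;
  star : A -> A;
  cmulA : associative cmul;
  cmulDl : forall x y z : A, cmul (x + y) z = cmul x z + cmul y z;
  cmulDr : forall x y z : A, cmul x (y + z) = cmul x y + cmul x z;
  cmulZl : forall (k : Cplx R) (x y : A), cmul (k *: x) y = k *: cmul x y;
  cmulZr : forall (k : Cplx R) (x y : A), cmul x (k *: y) = k *: cmul x y;
  cnormM : forall x y : A, `|cmul x y| <= `|x| * `|y|;
  starK : involutive star;
  starD : forall x y : A, star (x + y) = star x + star y;
  starZ : forall (k : Cplx R) (x : A), star (k *: x) = k^* *: star x;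
  starM : forall x y : A, star (cmul x y) = cmul (star y) (star x);
  cnorm_star : forall x : A, `|cmul (star x) x| = `|x| ^+ 2
}.

#[short(type="cstarAlgType")]
HB.structure Definition CStarAlgebra (R : realType) :=
  {A of CompleteNormedModule (Cplx R) A & isCStarAlgebra R A}.

Notation "x ** y" := (cmul x y) (at level 40, left associativity) : ring_scope.

Section CStarNotions.
Variables (R : realType) (A : cstarAlgType R).
Implicit Types (B I : set A) (a b c p : A).

Definition positive a : Prop := exists y : A, a = star y ** y.

Definition projection p : Prop := star p = p /\ p ** p = p.

Definition cstar_subalgebra B : Prop :=
  [/\ closed B, B 0,
      (forall (k : Cplx R) a b, B a -> B b -> B (k *: a + b)),
      (forall a b, B a -> B b -> B (a ** b))
    & (forall a, B a -> B (star a))].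

Definition hereditary B : Prop :=
  forall a b, B b -> positive a -> positive (b - a) -> B a.

Definition nonzero_set B : Prop := exists2 b, B b & b <> 0.

Definition property_SP : Prop :=
  forall B, cstar_subalgebra B -> hereditary B -> nonzero_set B ->
    exists p, [/\ B p, projection p & p <> 0].

(* Two-sided ideals, not assumed to be norm closed. *)
Definition two_sided_ideal I : Prop :=
  [/\ I 0,
      (forall (k : Cplx R) a b, I a -> I b -> I (k *: a + b))
    & (forall a b, I a -> I (a ** b) /\ I (b ** a))].

(* B is meant to be a C*-subalgebra; by Tomiyama's theorem the five clauses are
   equivalent to E being a projection of norm at most 1 onto B. *)
Definition conditional_expectation B (E : A -> A) : Prop :=
  [/\ linear E,
      (forall a, B (E a)) /\ (forall b, B b -> E b = b),
      (forall a, `|E a| <= `|a|),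
      (forall a, positive a -> positive (E a))
    & (forall b a b', B b -> B b' -> E (b ** a ** b') = b ** E a ** b')].

Definition faithful (E : A -> A) : Prop :=
  forall a, E (star a ** a) = 0 -> a = 0.

End CStarNotions.

Section CrossedProduct.
Variables (R : realType) (G : sepgraph) (S : dynsys G).
Local Notation F := (freeGroup (edge G)).
Implicit Types (g h : F) (a b : S -> Cplx R).

(* The ideal D_g of C(Omega); D_1 is C(Omega) itself. *)
Definition Dset g : set (S -> Cplx R) :=
  [set a | continuous a /\ forall t, ~ Uset g t -> a t = 0].

Definition alpha g a : S -> Cplx R :=
  fun t => if theta (g^-1)%g t is Some t' then a t' else 0.

Variables (A : cstarAlgType R) (delta : F -> (S -> Cplx R) -> A).

(* [delta g a] stands for the element written a delta_g (for a in D_g). *)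
Definition COmega : set A := delta 1%g @` [set a | continuous a].

Definition finite_sums : set A :=
  [set z | exists (s : seq F) (a : F -> S -> Cplx R),
     [/\ uniq s, (forall g, Dset g (a g)) & z = \sum_(g <- s) delta g (a g)]].

(* [A] is the completion of the *-algebra of finite sums of elements
   a_g delta_g in a C*-norm for which a |-> a_1 extends to a faithful
   conditional expectation. *)
Record is_reduced_crossed_product : Prop := {
  rcp_linear : forall g (k : Cplx R) a b, Dset g a -> Dset g b ->
    delta g ((k \*: a) \+ b) = k *: delta g a + delta g b;
  rcp_mul : forall g h a b, Dset g a -> Dset h b ->
    delta g a ** delta h b = delta (g * h)%g (alpha g (alpha (g^-1)%g a \* b));
  rcp_star : forall g a, Dset g a ->
    star (delta g a) = delta (g^-1)%g (alpha (g^-1)%g (fun t => (a t)^*));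
  rcp_inj : forall (s : seq F) (a : F -> S -> Cplx R), uniq s ->
    (forall g, Dset g (a g)) -> \sum_(g <- s) delta g (a g) = 0 ->
    forall g, g \in s -> a g = (fun=> 0);
  rcp_dense : closure finite_sums = [set: A];
  rcp_expectation : exists E : A -> A,
    [/\ conditional_expectation COmega E, faithful E
      & forall (s : seq F) (a : F -> S -> Cplx R), uniq s ->
          (forall g, Dset g (a g)) ->
          E (\sum_(g <- s) delta g (a g)) =
            if 1%g \in s then delta 1%g (a 1%g) else 0]
}.

End CrossedProduct.

(* Main.v *)
Require Import Defs.
From mathcomp Require Import all_boot all_order all_algebra.
From mathcomp Require Import all_classical all_reals all_analysis.
From mathcomp Require Import complex.
From mathcomp Require Import ring zify.
Set Implicit Arguments.
Unset Strict Implicit.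
Unset Printing Implicit Defensive.
Import Order.TTheory GRing.Theory Num.Theory numFieldNormedType.Exports.
Local Open Scope classical_set_scope.
Local Open Scope ring_scope.

(** Why the theorem is true.

    Condition (L) makes the partial action of the free group on Omega
    topologically free, and topological freeness lets one compress any positive
    element to an almost scalar element of a corner.

    Dynamics.  A point t of Omega has an itinerary, the set of words in the
    letters x, x^-1 that can be applied to it.  The closed set of all
    configurations, the subsets of words that look like itineraries, is itself a
    system under the shift, so universality identifies Omega with it
    ([universal_realize], [universal_basis]): Omega is zero-dimensional, every
    configuration is realised, and points are close when their itineraries agree
    on a finite set of words.  Suppose a reduced word g <> 1 fixes every point of
    a nonempty open set.  After conjugating, g is cyclically reduced and its
    powers of both signs spell a bi-infinite path in the tree of words applicable
    to a point t.  If far from the root, behind a copy of g or g^-1, some node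
    left open a choice of an edge, changing the tree only behind that node
    ([regrow]) would give a point near t which g cannot fix.  So all choices there
    are forced ([forced_state]); every path starting at a vertex of the axis can
    then be followed in the tree and is never an entry ([far_dead]).  This
    contradicts (L), which provides an entry at some vertex of every infinite
    admissible path ([infinite_path_entry]).

    Algebra.  Let c = y^* y be nonzero.  The faithful expectation E does not kill
    c; approximating y by a finite sum z gives a function f >= 0 with
    E (z^* z) = f delta_1, of norm close to that of E c, so f takes a value
    M = f (t0) of that size.  By topological freeness a small nonempty clopen set
    V near t0 is disjoint from its translates by the finitely many g <> 1 in the
    support of z^* z.  With q = 1_V delta_1 the compression q z^* z q is the
    function 1_V f, whence q c q is close to M q ([almost_scalar_compression]).
    An explicit contraction then produces x with x^* c x = q
    ([corner_inverse_sqrt]).  The statement on ideals follows by taking c = b^* b,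
    and property (SP) because q = (b x)^* (b x) is equivalent to the projection
    (b x) (b x)^*, which lies in every hereditary subalgebra containing b
    ([hereditary_conj]). *)

(** * The combinatorial meaning of condition (L) *)

Section Separation.
Variable G : sepgraph.
Implicit Types (x y e : edge G) (v : vert G) (X : {set edge G}).

Lemma sep_eclass x : eclass x \in sep (rng x).
Proof.
apply: pblock_mem; rewrite (cover_partition (sepP _)) inE; exact: eqxx.
Qed.

Lemma mem_eclass x : x \in eclass x.
Proof. by rewrite mem_pblock (cover_partition (sepP _)) inE. Qed.

Lemma rng_sep v X x : X \in sep v -> x \in X -> rng x = v.
Proof.
move=> hX xX.
have : x \in [set e | rng e == v]%SET.
  by rewrite -(cover_partition (sepP v)); apply/bigcupP; exists X.
by rewrite inE => /eqP.
Qed.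

Lemma eclass_sep v X x : X \in sep v -> x \in X -> X = eclass x.
Proof.
move=> hX xX; have rx := rng_sep hX xX.
have := def_pblock (partition_trivIset (sepP v)) hX xX.
by rewrite /eclass rx => ->.
Qed.

Lemma eclass_single x y :
  rng x = rng y -> x <> y -> (#|eclass y| < 2)%N -> eclass x <> eclass y.
Proof.
move=> rxy xy hy exy; have := hy; rewrite ltnNge => /negP; apply.
apply/card_gt1P; exists x, y; split; last by apply/eqP.
  by rewrite -exy mem_eclass.
exact: mem_eclass.
Qed.

(** If no source vertex of the path had an entry, every member of the separation
    met along the path would be a singleton, since the path can be entered in both
    directions; so distinct edges of the path with a common range lie in distinct
    members.  A shortest subpath returning to its first vertex is a cycle if its
    two end edges differ.  If they coincide, the second edge and the last but one
    differ, and moving the second edge to the end of what remains gives a cycle.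
    Both times (L) yields an entry. *)
Lemma infinite_path_entry (e : nat -> edge G) :
  condition_L G -> (forall m, admissible m e) ->
  exists i t p, (0 < i)%N /\ is_entry (e i.*2.-1) t p.
Proof.
move=> hL he; apply: contrapT => noentry.
have dead i t (p : nat -> edge G) : (0 < i)%N -> ~ is_entry (e i.*2.-1) t p.
  by move=> i0 hp; apply: noentry; exists i, t, p.
have rngE i : (0 < i)%N -> rng (e i.*2.-1) = rng (e i.*2).
  by move=> i0; case: (he i.*2) => /(_ i i0 (leqnn _))[].
have clsE i : (0 < i)%N -> eclass (e i.*2.-1) <> eclass (e i.*2).
  by move=> i0; case: (he i.*2) => /(_ i i0 (leqnn _))[].
have srcE i : (0 < i)%N -> src (e i.*2) = src (e i.*2.+1).
  by move=> i0; case: (he i.*2.+1) => _ /(_ i i0 (leqnn _))[].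
have neqE i : (0 < i)%N -> e i.*2.+1 <> e i.*2.
  by move=> i0; case: (he i.*2.+1) => _ /(_ i i0 (leqnn _))[].
have short y (i : nat) X : (0 < i)%N -> src y = src (e i.*2.-1) ->
    X \in sep (rng y) -> X <> eclass y -> (#|X| < 2)%N.
  move=> i0 sy hX Xy; rewrite ltnNge; apply/negP => cX.
  apply: (@dead i 1%N (fun=> y) i0); split => //; last by exists X.
  by split => -[//|j] _; rewrite doubleS.
have single i : (0 < i)%N -> (#|eclass (e i.*2)| < 2)%N.
  move=> i0; apply: (short (e i.*2.-1) i) => //.
    by rewrite rngE // sep_eclass.
  by move=> /esym/clsE; apply.
have single' i : (0 < i)%N -> (#|eclass (e i.*2.-1)| < 2)%N.
  move=> i0; apply: (short (e i.*2) i.+1) => //.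
  - by rewrite srcE // doubleS.
  - by rewrite -rngE // sep_eclass.
  - by move/clsE; apply.
suff norep d : forall i, (0 < i)%N -> src (e i.*2.-1) <> src (e (i + d).*2).
  pose f (i : 'I_#|vert G|.+1) := src (e i.*2.+1).
  have /injectivePn[i [j ij fij]] : ~~ injectiveb f.
    apply/injectiveP => /leq_card; rewrite card_ord; lia.
  wlog lij : i j ij fij / (i < j)%N.
    move=> H; case: (ltngtP i j) => [|ji|/val_inj/eqP]; first exact: H.
      by apply: (H j i) => //; rewrite eq_sym.
    by rewrite (negbTE ij).
  apply: (norep (j - i).-1 i.+1) => //.
  have -> : (i.+1 + (j - i).-1 = j)%N by lia.
  by rewrite srcE ?(leq_ltn_trans _ lij) // -[RHS]fij doubleS.
elim/ltn_ind: d => d IH i i0 rep.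
(* (L) would give such a cycle an entry at its first vertex *)
have cyc k f j : (0 < j)%N -> f 1%N = e j.*2.-1 -> closed_path k f ->
    f 1%N <> f k.*2 ->
    (forall a b, (0 < a)%N -> (a <= b)%N -> (b < k)%N ->
      src (f a.*2.-1) <> src (f b.*2)) -> False.
  move=> j0 fj cf ne nr; have [t [x hx]] := hL k f (And3 cf ne nr).
  by apply: (@dead j t x) => //; rewrite -fj.
case: (eqVneq (e i.*2.-1) (e (i + d).*2)) => [lol|/eqP ne]; last first.
  apply: (cyc d.+1 (fun k => e (i.-1.*2 + k)%N) i) => //.
  - congr e; lia.
  - split => //; last first.
      rewrite (_ : i.-1.*2 + 1 = i.*2.-1)%N; last by lia.
      by rewrite (_ : i.-1.*2 + d.+1.*2 = (i + d).*2)%N //; lia.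
    split=> a a0 ha.
      have -> : (i.-1.*2 + a.*2.-1 = (i.-1 + a).*2.-1)%N by lia.
      have -> : (i.-1.*2 + a.*2 = (i.-1 + a).*2)%N by lia.
      have p0 : (0 < i.-1 + a)%N by lia.
      by split; [exact: rngE|exact: clsE].
    have -> : (i.-1.*2 + a.*2.+1 = (i.-1 + a).*2.+1)%N by lia.
    have -> : (i.-1.*2 + a.*2 = (i.-1 + a).*2)%N by lia.
    have p0 : (0 < i.-1 + a)%N by lia.
    by split; [exact: srcE|exact: neqE].
  - have -> : (i.-1.*2 + 1 = i.*2.-1)%N by lia.
    by have -> : (i.-1.*2 + d.+1.*2 = (i + d).*2)%N by lia.
  - move=> a b a0 ab bd.
    have -> : (i.-1.*2 + a.*2.-1 = (i.-1 + a).*2.-1)%N by lia.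
    have -> : (i.-1.*2 + b.*2 = (i.-1 + a + (b - a)).*2)%N by lia.
    by apply: IH; lia.
(* the subpath begins and ends with the same edge *)
case: (posnP d) => [d0|d0].
  by move: lol; rewrite d0 addn0 => /(congr1 (@eclass G)); exact: clsE.
have ne : e (i + d).*2.-1 <> e i.*2.
  move=> h; case: (ltnP 1 d) => d1.
    apply: (IH (d - 2)%N _ i.+1) => //; first by lia.
    have -> : (i.+1 + (d - 2) = (i + d).-1)%N by lia.
    have -> : i.+1.*2.-1 = i.*2.+1 by lia.
    have id0 : (0 < (i + d).-1)%N by lia.
    rewrite srcE // -srcE // -h; congr (src (e _)); lia.
  apply: (neqE i) => //; rewrite -h; congr e; lia.
(* drop both ends and move the second edge e (2 i) to the end *)
pose f k := if k == d.*2 then e i.*2 else e (i.*2 + k)%N.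
have fl : f d.*2 = e i.*2 by rewrite /f eqxx.
have fs a : (a < d.*2)%N -> f a = e (i.*2 + a)%N.
  by move=> ad; rewrite /f; case: eqP => //; lia.
apply: (cyc d f i.+1) => //.
- rewrite fs; last by lia.
  congr e; lia.
- split => //; last first.
    rewrite fl fs; last by lia.
    by rewrite addn1 srcE.
  split=> a a0 ha.
    rewrite (fs a.*2.-1); last by lia.
    have -> : (i.*2 + a.*2.-1 = (i + a).*2.-1)%N by lia.
    have ia0 : (0 < i + a)%N by lia.
    case: (eqVneq a d) => [->|ad].
      rewrite fl; have rr : rng (e (i + d).*2.-1) = rng (e i.*2).
        by rewrite rngE ?addn_gt0 ?i0 // -lol rngE.
      by split => //; apply: eclass_single => //; exact: single.
    rewrite fs; last by lia.
    rewrite (_ : (i.*2 + a.*2 = (i + a).*2)%N); last by lia.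
    by split; [exact: rngE|exact: clsE].
  rewrite !fs; [|lia|lia].
  rewrite (_ : (i.*2 + a.*2 = (i + a).*2)%N); last by lia.
  rewrite (_ : (i.*2 + a.*2.+1 = (i + a).*2.+1)%N); last by lia.
  by split; [apply: srcE|apply: neqE]; lia.
- rewrite fl fs; last by lia.
  by rewrite addn1; exact: neqE.
- move=> a b a0 ab bd; rewrite !fs; [|lia|lia].
  have -> : (i.*2 + a.*2.-1 = (i + a).*2.-1)%N by lia.
  have -> : (i.*2 + b.*2 = (i + a + (b - a)).*2)%N by lia.
  by apply: IH; lia.
Qed.

End Separation.

(** * Locally constant functions and closed subspaces of Cantor cubes *)

Definition locally_constant (T : topologicalType) (B : Type) (f : T -> B) :=
  forall t, \forall t' \near t, f t' = f t.

Section LocallyConstant.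
Variable T : topologicalType.

Lemma locally_constant_comp (B C : Type) (f : T -> B) (g : B -> C) :
  locally_constant f -> locally_constant (g \o f).
Proof. by move=> hf t; apply: filterS (hf t) => t' /= ->. Qed.

Lemma locally_constant_clopen (B : Type) (f : T -> B) (P : B -> Prop) :
  locally_constant f -> clopen [set t | P (f t)].
Proof.
move=> hf; split.
  by rewrite openE => t /= Pt; apply: filterS (hf t) => t' /= ->.
move=> t ht; have [t' [/= Pt' et']] := ht _ (hf t).
by move: Pt'; rewrite et'.
Qed.

Lemma clopen_locally_constant (A : set T) :
  clopen A -> locally_constant (fun t => `[< A t >]).
Proof.
move=> [oA cA] t; have [At|nAt] := pselect (A t).
  apply: filterS (open_nbhs_nbhs (conj oA At)) => t' At'.
  by rewrite !asboolT.
have oC : open (~` A) by rewrite openC.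
apply: filterS (open_nbhs_nbhs (conj oC nAt)) => t' nAt'.
by rewrite !asboolF.
Qed.

Lemma locally_constant_seq (I : eqType) (B : Type) (f : I -> T -> B) (s : seq I) t :
  (forall i, locally_constant (f i)) ->
  \forall t' \near t, forall i, i \in s -> f i t' = f i t.
Proof.
move=> hf; elim: s => [|i s IH]; first exact: nearW.
apply: filterS2 (hf i t) IH => t' h1 h2 j; rewrite inE => /predU1P[->//|].
exact: h2.
Qed.

End LocallyConstant.

Section Cube.
Variables (I : choiceType) (A : set {ptws I -> bool}).

Lemma cube_coord_locally_constant i :
  locally_constant (fun z : {ptws I -> bool} => z i).
Proof.
move=> z; have := @proj_continuous I (fun=> bool) i z.
by move=> /(_ [set b | b = z i]); apply; rewrite nbhs_principalE => b ->.
Qed.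

Lemma cube_cvg (F : set_system {ptws I -> bool}) (z : {ptws I -> bool}) :
  Filter F -> (forall i, \forall z' \near F, z' i = z i) -> F --> z.
Proof.
move=> FF hF; apply/cvg_sup => i U [V [[W oW <-] Wz]] /filterS; apply.
by apply: filterS (hF i) => z' /= ->.
Qed.

Lemma subcube_coord_locally_constant i :
  locally_constant (fun z : set_type A => set_val z i).
Proof.
move=> z.
exact: (@initial_continuous _ _ (set_val : A -> _) z
          [set z' | z' i = set_val z i] (cube_coord_locally_constant i _)).
Qed.

Lemma subcube_cvg (T : Type) (F : set_system T) (f : T -> set_type A) (z : set_type A) :
  Filter F -> (forall i, \forall t \near F, set_val (f t) i = set_val z i) ->
  f @ F --> z.
Proof.
move=> FF hF.
have h : (set_val \o f) @ F --> set_val z by apply: cube_cvg => i; exact: hF.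
move=> U [V [[W oW <-] Wz]] WU; have {}h : F [set t | W (set_val (f t))] := h W (open_nbhs_nbhs (conj oW Wz)).
change (F (f @^-1` U)); apply: (filterS _ h) => t Wt; exact: (WU (f t) Wt).
Qed.

Lemma subcube_compact : closed A -> compact [set: set_type A].
Proof.
move=> cA F PF _.
have cC : compact [set: {ptws I -> bool}].
  have := @tychonoff I (fun=> bool) (fun=> setT) (fun=> bool_compact).
  by congr (compact _); rewrite eqEsubset.
have cA' : compact A by apply: subclosed_compact cC _.
have PG : ProperFilter ((set_val : A -> _) @ F) by exact: fmap_proper_filter.
have GA : ((set_val : A -> _) @ F) A.
  change (F ((set_val : A -> _) @^-1` A)).
  by apply: (filterS _ filterT) => -[z hz] _; exact: set_mem hz.
have [p [Ap hp]] := cA' _ PG GA.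
exists (exist _ p (mem_set Ap)); split=> // B C FB [D [[W oW <-] Wp WC]].
have FB' : ((set_val : A -> _) @ F) ((set_val : A -> _) @` B).
  change (F ((set_val : A -> _) @^-1` ((set_val : A -> _) @` B))).
  by apply: (filterS _ FB) => z Bz; exists z.
have [_ [[z Bz <-] Wz]] := hp _ W FB' (open_nbhs_nbhs (conj oW Wp)).
by exists z; split => //; apply: WC.
Qed.

Lemma subcube_hausdorff : hausdorff_space (set_type A).
Proof.
move=> p q cpq; apply: val_inj; apply/funext => i.
have [z [/= zp zq]] := cpq _ _ (subcube_coord_locally_constant i p)
  (subcube_coord_locally_constant i q).
exact: etrans (esym zp) zq.
Qed.

End Cube.

(** * Words acting on a dynamical system *)

Section Words.
Variable X : choiceType.
Implicit Types (a b : letter X) (u v w : seq (letter X)).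

Definition red w : seq (letter X) := lmul w [::].
Arguments red : simpl never.

Lemma red_reduced w : reduced (red w).
Proof. exact: reduced_lmul. Qed.

Lemma red_cons a w : red (a :: w) = lcons a (red w).
Proof. by []. Qed.

Lemma size_lcons a w : (size (lcons a w) <= (size w).+1)%N.
Proof. by case: w => [|b w] //=; case: ifP => //= _; lia. Qed.

Lemma size_red w : (size (red w) <= size w)%N.
Proof.
elim: w => [//|a w IH]; rewrite red_cons.
by apply: leq_trans (size_lcons _ _) _; rewrite /= ltnS.
Qed.

Lemma reduced_cons2 a b w :
  reduced (a :: b :: w) = (b != linv a) && reduced (b :: w).
Proof. by []. Qed.

Lemma reduced_consW a w : reduced (a :: w) -> reduced w.
Proof. exact: path_sorted. Qed.

Lemma red_id w : reduced w -> red w = w.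
Proof. exact: lmulw1. Qed.

Lemma reduced_catl u v : reduced (u ++ v) -> reduced u.
Proof. by elim: u => [//|a [//|b u] IH] /= /andP[h /IH]; rewrite /reduced /= h. Qed.

Lemma winv_cons a w : winv (a :: w) = rcons (winv w) (linv a).
Proof. by rewrite /winv /= rev_cons. Qed.

Lemma winv_cat u v : winv (u ++ v) = winv v ++ winv u.
Proof. by rewrite /winv map_cat rev_cat. Qed.

Lemma size_winv w : size (winv w) = size w.
Proof. by rewrite /winv size_rev size_map. Qed.

End Words.

Arguments red : simpl never.

Section Action.
Variables (G : sepgraph) (S : dynsys G).
Local Notation ltr := (letter (edge G)).
Implicit Types (a b : ltr) (w : seq ltr) (v : vert G) (t : S).

(** [theta_word w] is the composition of the letters of a word which need not
    be reduced. *)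
Definition theta_word w t : option S :=
  foldr (fun a o => obind (theta_letter a) o) (Some t) w.

Lemma theta_word_cons a w t :
  theta_word (a :: w) t = obind (@theta_letter _ S a) (theta_word w t).
Proof. by []. Qed.

Lemma theta_word_cat w1 w2 t :
  theta_word (w1 ++ w2) t = obind (theta_word w1) (theta_word w2 t).
Proof.
elim: w1 => [|a w1 IH] /=; first by case: (theta_word w2 t).
by rewrite IH; case: (theta_word w2 t).
Qed.

(** All points to which a can be applied lie over this vertex. *)
Definition letter_vertex a : vert G := if a.2 then rng a.1 else src a.1.

Lemma theta_letter_linv a t t' :
  theta_letter a t = Some t' -> theta_letter (linv a) t' = Some t.
Proof.
case: a => x []; rewrite /theta_letter /linv /=; case: asboolP => // h [<-].
  have [_ h2 _ h4 _] := dthetaP S x.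
  rewrite asboolT; last by apply: h2; exists t.
  by rewrite h4.
have [h1 _ h3 _ _] := dthetaP S x.
rewrite asboolT; last by apply: h1; exists t.
by rewrite h3.
Qed.

Lemma theta_wordK a w t :
  theta_word (a :: w) t -> theta_word (linv a :: a :: w) t = theta_word w t.
Proof.
rewrite /=; case: (theta_word w t) => //= t1.
case e: (theta_letter a t1) => [t2|] //= _.
exact: theta_letter_linv e.
Qed.

Lemma theta_word_lcons a w t :
  theta_word (a :: w) t -> theta_word (lcons a w) t = theta_word (a :: w) t.
Proof.
case: w => [//|b w]; rewrite [lcons _ _]/=; case: ifP => [/eqP ->|//] h.
have := @theta_wordK (linv a) w t; rewrite linvK => -> //.
by move: h; rewrite theta_word_cons; case: (theta_word (linv a :: w) t).
Qed.

Lemma theta_word_red w t : theta_word w t -> theta_word (red w) t = theta_word w t.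
Proof.
elim: w => [//|a w IH] h; have hw : theta_word w t.
  by move: h; rewrite /=; case: (theta_word w t).
have e : theta_word (a :: red w) t = theta_word (a :: w) t by rewrite /= IH.
by rewrite red_cons theta_word_lcons e.
Qed.

Lemma theta_word_winv w t t' :
  theta_word w t = Some t' -> theta_word (winv w) t' = Some t.
Proof.
elim: w t' => [|a w IH] t' /=; first by move=> [->].
case e: (theta_word w t) => [t1|] //= ha.
rewrite winv_cons -cats1 theta_word_cat /= (theta_letter_linv ha) /=.
exact: IH.
Qed.

(** The local configuration of t: it records the vertex of t and the edges x with
    t in H_x. *)
Definition state t : {set ltr} := [set a | isSome (@theta_letter _ S a t)]%SET.

Lemma state_pos x t : ((x, false) \in state t) = `[< dvert S (src x) t >].
Proof. by rewrite inE /theta_letter /=; case: asboolP. Qed.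

Lemma state_neg x t : ((x, true) \in state t) = `[< dedge S x t >].
Proof. by rewrite inE /theta_letter /=; case: asboolP. Qed.

Lemma dvert_ex t : exists v, dvert S v t.
Proof.
have : (\bigcup_v dvert S v) t by rewrite dvert_cover.
by case=> v _ h; exists v.
Qed.

Lemma dvert_inj v v' t : dvert S v t -> dvert S v' t -> v = v'.
Proof. by move=> h h'; apply: (@dvert_disj G S v v' I I); exists t. Qed.

Lemma dedge_vert x t : dedge S x t -> dvert S (rng x) t.
Proof. exact: dedge_sub. Qed.

End Action.

(** What the state of a point of vertex v may be.  For a bipartite graph only one
    of the second and third clauses has content, but the uniform definition avoids
    a case distinction. *)
Definition local_state (G : sepgraph) (v : vert G) (L : {set letter (edge G)}) :
    Prop :=
  [/\ forall a, a \in L -> letter_vertex a = v,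
      forall x, src x = v -> (x, false) \in L,
      forall X, X \in sep v -> exists2 x, x \in X & (x, true) \in L
    & forall x y, (x, true) \in L -> (y, true) \in L ->
        eclass x = eclass y -> x = y].

Section States.
Variables (G : sepgraph) (S : dynsys G).
Local Notation ltr := (letter (edge G)).
Implicit Types (a b : ltr) (w : seq ltr) (v : vert G) (t : S).

Lemma state_local v t : dvert S v t -> local_state v (state t).
Proof.
move=> tv; split.
- case=> x [].
    by rewrite state_neg => /asboolP/dedge_vert/dvert_inj; apply.
  by rewrite state_pos => /asboolP/dvert_inj; apply.
- by move=> x sx; rewrite state_pos sx; apply/asboolP.
- move=> X hX; have : (\bigcup_(x in [set` X]) dedge S x) t.
    by rewrite (dedge_cover _ hX).
  by case=> x /= xX tx; exists x => //; rewrite state_neg; apply/asboolP.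
- move=> x y; rewrite !state_neg => /asboolP tx /asboolP ty exy.
  apply: (dedge_disj (sep_eclass x)); last by exists t.
    exact: mem_eclass.
  by rewrite exy; exact: mem_eclass.
Qed.

Lemma theta_letter_vertex a t t' :
  theta_letter a t = Some t' ->
  dvert S (letter_vertex a) t /\ dvert S (letter_vertex (linv a)) t'.
Proof.
have H b t1 t2 : theta_letter b t1 = Some t2 -> dvert S (letter_vertex b) t1.
  case: b => x []; rewrite /theta_letter /letter_vertex /=; case: asboolP => //.
  by move=> /dedge_vert.
by move=> h; split; [exact: H h|exact: H (theta_letter_linv h)].
Qed.

Definition itinerary t : seq ltr -> bool := fun w => isSome (theta_word w t).

Lemma itinerary_cons a w t t' : theta_word w t = Some t' ->
  itinerary t (a :: w) = (a \in state t').
Proof. by rewrite /itinerary /= => ->; rewrite inE. Qed.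

Lemma itinerary_suffix w1 w t : itinerary t (w1 ++ w) -> itinerary t w.
Proof. by rewrite /itinerary theta_word_cat; case: (theta_word w t). Qed.

Lemma itineraryE t w : itinerary t w -> exists t', theta_word w t = Some t'.
Proof. by rewrite /itinerary; case: (theta_word w t) => // t' _; exists t'. Qed.

Lemma theta_letter_locally_constant a :
  locally_constant (fun t : S => isSome (theta_letter a t)).
Proof.
have E : (fun t : S => isSome (theta_letter a t)) = if a.2 then
    (fun t : S => `[< dedge S a.1 t >]) else (fun t : S => `[< dvert S (src a.1) t >]).
  by apply/funext => t; rewrite /theta_letter; case: a.2; case: asboolP.
rewrite E; case: a.2; apply: clopen_locally_constant.
  exact: dedge_clopen.
exact: dvert_clopen.
Qed.

(** Letters are partial homeomorphisms with clopen, hence open, domains. *)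
Lemma theta_letter_near a t t' (W : set S) :
  theta_letter a t = Some t' -> nbhs t' W ->
  \forall u \near t, exists2 u', theta_letter a u = Some u' & W u'.
Proof.
have within_near (A : set S) (f : S -> S) (s : S) : open A -> A s ->
    {within A, continuous f} -> nbhs (f s) W ->
    \forall u \near s, A u /\ W (f u).
  move=> oA As; rewrite (continuous_open_subspace _ oA) => cf Wf.
  have h : \forall u \near s, W (f u) by apply: (cf s (mem_set As)).
  by apply: filterS2 (open_nbhs_nbhs (conj oA As)) h.
case: a => x []; rewrite /theta_letter /=; case: asboolP => // tA [<-] Wt.
  have [_ _ _ _ [_ cf]] := dthetaP S x.
  have [oA _] := dedge_clopen S x.
  apply: filterS (within_near _ _ _ oA tA cf Wt) => u [Au Wu].
  by rewrite asboolT //; exists (dthetaV S x u).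
have [_ _ _ _ [cf _]] := dthetaP S x.
have [oA _] := dvert_clopen S (src x).
apply: filterS (within_near _ _ _ oA tA cf Wt) => u [Au Wu].
by rewrite asboolT //; exists (dtheta S x u).
Qed.

Lemma theta_word_near w t t' (W : set S) :
  theta_word w t = Some t' -> nbhs t' W ->
  \forall u \near t, exists2 u', theta_word w u = Some u' & W u'.
Proof.
elim: w t' W => [|a w IH] t' W /=.
  by move=> [->]; apply: filterS => u Wu; exists u.
case e: (theta_word w t) => [t1|] //= ha hW.
have := IH _ _ e (theta_letter_near ha hW).
apply: filterS => u [u1 e1 [u2 e2 Wu2]].
by exists u2 => //; rewrite /= e1.
Qed.

Lemma itinerary_locally_constant w :
  locally_constant (fun t => itinerary t w).
Proof.
elim: w => [|a w IH] t; first exact: nearW.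
case e: (theta_word w t) => [t1|]; last first.
  apply: filterS (IH t) => u; rewrite /itinerary /= e.
  by case: (theta_word w u).
have := theta_word_near e (theta_letter_locally_constant a t1).
apply: filterS => u [u1 e1 h1].
by rewrite /itinerary /= e1 e /= h1.
Qed.

End States.

(** Equivariance only requires inclusions, but the Omega_v, and the H_x for x in
    one member of the separation, are partitions; so domains are also
    reflected. *)
Lemma equivariant_itinerary (G : sepgraph) (S S' : dynsys G) (f : S -> S') w t :
  equivariant f -> theta_word w (f t) = omap f (theta_word w t).
Proof.
move=> [hv he hth].
have vP v s : dvert S' v (f s) <-> dvert S v s.
  split=> [h|h]; last by apply: hv; exists s.
  have [v' h'] := dvert_ex s; suff -> : v = v' by [].
  by apply: (dvert_inj h); apply: hv; exists s.
have eP x s : dedge S' x (f s) <-> dedge S x s.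
  split=> [h|h]; last by apply: he; exists s.
  have sv : dvert S (rng x) s by apply/vP; exact: dedge_vert.
  have [_ _ /(_ _ (sep_eclass x)) [y yX]] := state_local sv.
  rewrite state_neg => /asboolP sy _.
  suff -> : x = y by [].
  apply: (dedge_disj (sep_eclass x) (mem_eclass x) yX).
  by exists (f s); split => //; apply: he; exists s.
suff hl a s : theta_letter a (f s) = omap f (theta_letter a s).
  elim: w => [//|a w IH]; rewrite !theta_word_cons IH.
  by case: (theta_word w t) => [s|] //=; exact: hl.
case: a => x []; rewrite /theta_letter /=.
  rewrite (_ : `[< dedge S' x (f s) >] = `[< dedge S x s >]); last first.
    exact/asbool_equiv_eq.
  case: asboolP => //= sx; congr Some.
  have [_ h2 _ h4 _] := dthetaP S x.
  have sv : dvert S (src x) (dthetaV S x s) by apply: h2; exists s.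
  have [_ _ h3' _ _] := dthetaP S' x.
  by rewrite -{1}(h4 _ sx) hth // h3' //; apply/vP.
rewrite (_ : `[< dvert S' (src x) (f s) >] = `[< dvert S (src x) s >]); last first.
  exact/asbool_equiv_eq.
by case: asboolP => //= sx; rewrite hth.
Qed.

(** * The symbolic model of the universal system *)

Section Model.
Variable G : sepgraph.
Local Notation ltr := (letter (edge G)).
Implicit Types (a b : ltr) (w : seq ltr) (z : {ptws seq ltr -> bool}).

(** Words need not be reduced, which makes the shift a mere concatenation; the
    last clause accounts for cancellation. *)
Definition configuration (z : seq ltr -> bool) : Prop :=
  [/\ z [::],
      forall a w, z (a :: w) -> z w,
      forall w, z w -> exists v, local_state v [set a | z (a :: w)]%SET
    & forall w1 a w, z (a :: w) -> z (w1 ++ linv a :: a :: w) = z (w1 ++ w)].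

Lemma itinerary_configuration (S : dynsys G) (t : S) :
  configuration (itinerary t).
Proof.
split => //.
- by move=> a w; exact: (@itinerary_suffix _ _ [:: a]).
- move=> w /itineraryE[t' e]; have [v hv] := dvert_ex t'.
  exists v; have := state_local hv; congr local_state.
  by apply/setP => a; rewrite [RHS]inE (itinerary_cons _ e).
- move=> w1 a w h; rewrite /itinerary !theta_word_cat theta_wordK //.
Qed.

(** Each clause involves finitely many words only. *)
Lemma configuration_closed :
  closed [set z : {ptws seq ltr -> bool} | configuration z].
Proof.
move=> z hz.
have approx (s : seq (seq ltr)) : exists2 z', configuration z' &
    forall w, w \in s -> z' w = z w.
  have [z' [cz' hz']] := hz _ (locally_constant_seq s z
    (@cube_coord_locally_constant (seq ltr))).
  by exists z'.
split.
- have [z' [h _ _ _] e] := approx [:: [::]].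
  by rewrite -e // inE.
- move=> a w; have [z' [_ h _ _] e] := approx [:: a :: w; w].
  by rewrite -!e ?inE ?eqxx ?orbT //; exact: h.
- move=> w; have [z' [_ _ h _] e] :=
    approx (w :: [seq a :: w | a <- enum {: edge G * bool}]).
  rewrite -e ?inE ?eqxx // => /h[v hv]; exists v.
  move: hv; congr local_state; apply/setP => a; rewrite !inE e //.
  by rewrite inE map_f ?orbT // mem_enum.
- move=> w1 a w; have [z' [_ _ _ h] e] :=
    approx [:: a :: w; w1 ++ linv a :: a :: w; w1 ++ w].
  by rewrite -!e ?inE ?eqxx ?orbT //; exact: h.
Qed.

Definition model := set_type [set z : {ptws seq ltr -> bool} | configuration z].

Lemma modelP (z : model) : configuration (set_val z).
Proof. exact: set_valP. Qed.

Lemma model_inj (z z' : model) :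
  (forall w, set_val z w = set_val z' w) -> z = z'.
Proof. by move=> h; apply: val_inj; apply/funext. Qed.

Definition to_model (z : seq ltr -> bool) (cz : configuration z) : model :=
  exist _ (z : {ptws seq ltr -> bool}) (mem_set cz).

Lemma to_modelE z (cz : configuration z) w : set_val (to_model cz) w = z w.
Proof. by []. Qed.

Lemma shift_configuration (z : seq ltr -> bool) a : configuration z -> z [:: a] ->
  configuration (fun w => z (w ++ [:: a])).
Proof.
move=> [h1 h2 h3 h4] za; split => //.
- by move=> b w; exact: h2.
- by move=> w /h3.
- move=> w1 b w h; rewrite -!catA /=; exact: h4.
Qed.

(** Being the identity off the clopen domain of the letter keeps the map
    continuous on the whole model. *)
Definition shift a (z : model) : model :=
  match pselect (set_val z [:: a]) with
  | left za => to_model (shift_configuration (modelP z) za)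
  | right _ => z
  end.

Lemma shiftE a (z : model) w :
  set_val (shift a z) w =
  if set_val z [:: a] then set_val z (w ++ [:: a]) else set_val z w.
Proof.
rewrite /shift; case: pselect => [h|h]; first by rewrite to_modelE h.
by case: ifPn => // /h.
Qed.

Lemma shift_continuous a : continuous (shift a).
Proof.
move=> z; apply: (@subcube_cvg _ _ _ _ (shift a) (shift a z) (nbhs_filter z)) => w.
pose C := @subcube_coord_locally_constant (seq ltr)
  [set z : {ptws seq ltr -> bool} | configuration z].
apply: filterS3 (C [:: a] z) (C (w ++ [:: a]) z) (C w z) => z' h1 h2 h3.
by rewrite !shiftE h1 h2 h3.
Qed.

Lemma shift_dom a (z : model) : set_val z [:: a] ->
  set_val (shift a z) [:: linv a].
Proof.
move=> h; rewrite shiftE h /=.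
have [h1 _ _ h4] := modelP z.
by have := h4 [::] a [::] h; rewrite /= => ->.
Qed.

Lemma shiftK a (z : model) : set_val z [:: a] -> shift (linv a) (shift a z) = z.
Proof.
move=> h; apply: model_inj => w; rewrite shiftE shift_dom // shiftE h.
have [_ _ _ h4] := modelP z.
by rewrite -catA /= h4 // cats0.
Qed.

Definition model_state (z : model) : {set ltr} :=
  [set a | set_val z [:: a]]%SET.

Definition model_vert v : set model := [set z : model | local_state v (model_state z)].

Definition model_edge x : set model := [set z : model | set_val z [:: (x, true)] = true :> bool].

Lemma model_state_locally_constant : locally_constant model_state.
Proof.
move=> z; have := locally_constant_seq (enum {: edge G * bool}) z
  (fun a => @subcube_coord_locally_constant (seq ltr)
     [set z : {ptws seq ltr -> bool} | configuration z] [:: a]).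
apply: filterS => z' h; apply/setP => a; rewrite !inE.
by apply: h; rewrite mem_enum.
Qed.

Lemma model_state_local (z : model) : exists v, local_state v (model_state z).
Proof. by have [h1 _ h3 _] := modelP z; exact: h3 h1. Qed.

Lemma model_vertE x : model_vert (src x) = [set z : model | set_val z [:: (x, false)] = true :> bool].
Proof.
apply/seteqP; split=> z /=.
  by move=> [_ /(_ x erefl) + _ _]; rewrite inE.
move=> zx; rewrite /model_vert /=; have [v hv] := model_state_local z.
suff -> : src x = v by [].
by case: hv => /(_ (x, false)) + _ _ _; apply; rewrite inE.
Qed.

Lemma shift_homeo x :
  homeo_on (model_vert (src x)) (model_edge x) (shift (x, false)) (shift (x, true)).
Proof.
rewrite model_vertE; split.
- by move=> _ [z /= h <-]; exact: (shift_dom h).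
- by move=> _ [z /= h <-]; exact: (shift_dom h).
- by move=> z /= h; exact: (shiftK h).
- by move=> z /= h; exact: (shiftK h).
- by split; apply: continuous_subspaceT; exact: shift_continuous.
Qed.

Hypothesis hG : bipartite G.

Lemma bipartite_vertex v : (exists x : edge G, rng x = v) \/ (exists x : edge G, src x = v).
Proof.
case: hG => V0 [hr hs]; case: (boolP (v \in V0)).
  by rewrite -hr => /imsetP[x _ ->]; left; exists x.
move=> vV0; have : v \in (~: V0)%SET by rewrite inE.
by rewrite -hs => /imsetP[x _ ->]; right; exists x.
Qed.

Lemma bipartite_rng_src (x y : edge G) : rng x <> src y.
Proof.
case: hG => V0 [hr hs] e.
have : src y \in (~: V0)%SET by rewrite -hs imset_f.
by rewrite inE -e -hr imset_f.
Qed.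

(** In a bipartite graph every vertex has an applicable letter, which tells the
    vertex. *)
Lemma local_state_inj (v v' : vert G) L : local_state v L -> local_state v' L -> v = v'.
Proof.
move=> [h1 h2 h3 _] [h1' _ _ _].
case: (bipartite_vertex v) => [[x rx]|[x sx]].
  have [|y _ yL] := h3 (eclass x); first by rewrite -rx sep_eclass.
  by rewrite -(h1 _ yL) (h1' _ yL).
by rewrite -(h1 _ (h2 x sx)) (h1' _ (h2 x sx)).
Qed.

Lemma model_vert_clopen v : clopen (model_vert v).
Proof.
exact: (locally_constant_clopen (local_state v) model_state_locally_constant).
Qed.

Lemma model_edge_clopen x : clopen (model_edge x).
Proof.
apply: (locally_constant_clopen (fun b : bool => b)).
exact: subcube_coord_locally_constant.
Qed.

Lemma model_edgeP v (X : {set edge G}) (z : model) : X \in sep v ->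
  model_vert v z <-> (\bigcup_(x in [set` X]) model_edge x) z.
Proof.
move=> hX; split=> [[_ _ /(_ X hX)[x xX zx] _]|[x /= xX zx]].
  by exists x => //; move: zx; rewrite inE.
have [u hu] := model_state_local z; suff -> : v = u by [].
rewrite -(rng_sep hX xX); case: hu => /(_ (x, true)) + _ _ _; apply.
by rewrite inE.
Qed.

Lemma model_vert_cover : \bigcup_v model_vert v = [set: model].
Proof.
by apply/seteqP; split=> // z _; have [v hv] := model_state_local z; exists v.
Qed.

Lemma model_vert_disj : trivIset setT model_vert.
Proof. by move=> v v' _ _ [z [zv zv']]; exact: local_state_inj zv zv'. Qed.

Lemma model_edge_sub x : model_edge x `<=` model_vert (rng x).
Proof.
move=> z zx; apply/(model_edgeP z (sep_eclass x)).
by exists x => //=; exact: mem_eclass.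
Qed.

Lemma model_edge_cover v (X : {set edge G}) : X \in sep v ->
  \bigcup_(x in [set` X]) model_edge x = model_vert v.
Proof. by move=> hX; apply/seteqP; split=> z /(model_edgeP z hX). Qed.

Lemma model_edge_disj v (X : {set edge G}) : X \in sep v ->
  trivIset [set` X] model_edge.
Proof.
move=> hX x y /= xX yX [z [zx zy]]; have [u [_ _ _ h]] := model_state_local z.
by apply: h; rewrite ?inE // -(eclass_sep hX xX) -(eclass_sep hX yX).
Qed.

Definition model_system : dynsys G :=
  @DynSys G model (subcube_compact configuration_closed) (@subcube_hausdorff _ _)
    model_vert model_vert_clopen model_vert_cover model_vert_disj
    model_edge model_edge_clopen model_edge_sub model_edge_cover model_edge_disj
    (fun x => shift (x, false)) (fun x => shift (x, true)) shift_homeo.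

Lemma model_letter a (z : model_system) :
  theta_letter a z = if set_val (z : model) [:: a] then Some (shift a z) else None.
Proof.
case: a => x []; rewrite /theta_letter /=.
  by rewrite /model_edge /= asboolb.
by rewrite model_vertE /= asboolb.
Qed.

Lemma model_itinerary (z : model_system) w :
  itinerary z w = set_val (z : model) w.
Proof.
have [h1 h2 _ _] := modelP z.
suff H : match theta_word w z with
         | Some z' => set_val (z : model) w /\
             forall w', set_val (z' : model) w' = set_val (z : model) (w' ++ w)
         | None => ~~ set_val (z : model) w
         end.
  by rewrite /itinerary; case: theta_word H => [z' [-> _]//|/negbTE ->].
elim: w => [|a w]; first by split=> // w; rewrite cats0.
rewrite theta_word_cons; case: (theta_word w z) => [z' [zw IH]|] /=; last first.
  by apply: contra => /h2.
rewrite model_letter IH /=; case: ifP => [zaw|/negbT //]; split=> // w'.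
by rewrite shiftE IH /= zaw IH -catA.
Qed.

Variables (Omega : dynsys G) (hO : universal Omega).

Definition itinerary_map (t : Omega) : model_system :=
  to_model (itinerary_configuration t).

Lemma itinerary_map_continuous : continuous itinerary_map.
Proof.
by move=> t; apply: subcube_cvg => w; exact: itinerary_locally_constant.
Qed.

Lemma itinerary_map_equivariant : equivariant itinerary_map.
Proof.
have stE t : model_state (itinerary_map t) = state t.
  by apply/setP => a; rewrite inE to_modelE.
split.
- by move=> v _ [t tv <-]; rewrite /= /model_vert /= stE; exact: state_local.
- move=> x _ [t tx <-].
  suff : (x, true) \in state t by rewrite -stE inE.
  by rewrite state_neg; apply/asboolP.
- move=> x t tx; apply: model_inj => w; rewrite [RHS]shiftE !to_modelE.
  have e : theta_word [:: (x, false)] t = Some (dtheta Omega x t).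
    by rewrite /= /theta_letter /= asboolT.
  rewrite /itinerary e /= theta_word_cat e /=.
  by [].
Qed.

(** The composite with the itinerary map is an equivariant endomorphism of Omega,
    hence the identity by the uniqueness part of universality. *)
Lemma universal_retraction : exists psi : model_system -> Omega,
  [/\ continuous psi, equivariant psi & forall t, psi (itinerary_map t) = t].
Proof.
have [psi [[cpsi epsi] _]] := hO model_system; exists psi; split=> // t.
have [f [_ uf]] := hO Omega.
have eid : continuous (@id Omega) /\ equivariant (@id Omega).
  split; first by move=> s; exact: cvg_id.
  by split=> // [v|x]; rewrite image_id.
have ecomp : continuous (psi \o itinerary_map) /\ equivariant (psi \o itinerary_map).
  split.
    move=> s; apply: continuous_comp; first exact: itinerary_map_continuous.
    exact: cpsi.
  have [i1 i2 i3] := itinerary_map_equivariant; have [p1 p2 p3] := epsi.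
  split.
  - by move=> v _ [s sv <-]; apply: p1; exists (itinerary_map s) => //; apply: i1; exists s.
  - by move=> x _ [s sx <-]; apply: p2; exists (itinerary_map s) => //; apply: i2; exists s.
  - by move=> x s sx /=; rewrite i3 // p3 //; apply: i1; exists s.
have := uf _ ecomp; rewrite (uf _ eid) => /(congr1 (fun g => g t)) /= <-.
by [].
Qed.

(** The equivariant map from the model preserves itineraries. *)
Lemma universal_realize (z : seq ltr -> bool) : configuration z ->
  exists t : Omega, forall w, itinerary t w = z w.
Proof.
move=> cz; have [psi [_ epsi _]] := universal_retraction.
exists (psi (to_model cz)) => w.
rewrite /itinerary (equivariant_itinerary _ _ epsi).
have := model_itinerary (to_model cz) w; rewrite to_modelE /itinerary => <-.
by case: theta_word.
Qed.

(** The itinerary map is an embedding into a Cantor cube, so the sets of points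
    with prescribed itinerary on finitely many words form a basis. *)
Lemma universal_basis (t : Omega) (W : set Omega) : nbhs t W ->
  exists s : seq (seq ltr),
    forall t', (forall w, w \in s -> itinerary t' w = itinerary t w) -> W t'.
Proof.
move=> tW; have [psi [cpsi _ psiK]] := universal_retraction.
pose F := filter_from setT (fun s : seq (seq ltr) =>
  [set t' : Omega | forall w, w \in s -> itinerary t' w = itinerary t w]).
have FF : Filter F.
  apply: filter_from_filter; first by exists [::].
  move=> s1 s2 _ _; exists (s1 ++ s2) => // t' h.
  by split=> w hw; apply: h; rewrite mem_cat hw ?orbT.
have cF : itinerary_map @ F --> itinerary_map t.
  apply: subcube_cvg => w; exists [:: w] => // t' h.
  by rewrite /= !to_modelE h // inE.
have : nbhs (psi (itinerary_map t)) W by rewrite psiK.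
move=> /cpsi /cF [s _ hs]; exists s => t' h.
by have := hs t' h; rewrite /= psiK.
Qed.

End Model.

(** * Growing configurations along trees of reduced words *)

Section Grow.
Variable G : sepgraph.
Local Notation ltr := (letter (edge G)).
Implicit Types (a b c : ltr) (h w : seq ltr).

(** [Lset h] prescribes the letters applicable at the node h of the tree of reduced
    words; [grow] tells whether a word, read from its right end and possibly
    backtracking, stays in the tree so defined. *)
Fixpoint grow (Lset : seq ltr -> {set ltr}) w : bool :=
  if w is a :: w' then grow Lset w' && (a \in Lset (red w')) else true.

Lemma grow_red Lset w : grow Lset w -> grow Lset (red w).
Proof.
elim: w => [//|a w IH] /= /andP[/IH gw aL]; rewrite red_cons.
have := red_reduced w; move: gw aL; case: (red w) => [|b h] /=; first by rewrite /red /= => _ ->.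
move=> /andP[gh bh] aL hr; case: ifP => // _.
by rewrite /= gh bh /= red_id.
Qed.

Lemma grow_configuration Lset :
  (forall h, reduced h -> grow Lset h -> exists v, local_state v (Lset h)) ->
  (forall b h, reduced (b :: h) -> grow Lset (b :: h) -> linv b \in Lset (b :: h)) ->
  configuration (grow Lset).
Proof.
move=> H1 H2; split => //.
- by move=> a w /= /andP[].
- move=> w gw; have [v hv] := H1 _ (red_reduced w) (grow_red gw).
  by exists v; move: hv; congr local_state; apply/setP => a; rewrite inE /= gw.
- move=> w1 a w gaw; have /= /andP[gw aL] := gaw.
  have back : linv a \in Lset (red (a :: w)).
    have := grow_red gaw; have := red_reduced (a :: w).
    rewrite red_cons; have := red_reduced w; have := grow_red gw.
    case: (red w) => [_ _ r|b h]; first exact: H2 r.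
    rewrite /lcons; case: eqP => [->|_]; last by move=> _ _ r; exact: H2 r.
    by move=> /= /andP[_ +] hr _ _; rewrite (red_id (reduced_consW hr)).
  elim: w1 => [|b w1 /= ->]; first by rewrite /= gw aL back.
  congr (_ && (_ \in Lset _)); rewrite /red /lmul !foldr_cat /=.
  by congr foldr; rewrite -{2}(linvK a) lconsK // red_reduced.
Qed.

(** A local state in which a is applicable: the other members of the separation
    are left to an arbitrary choice. *)
Definition default_state a : {set ltr} :=
  let rep (X : {set edge G}) :=
    if a.2 && (a.1 \in X) then a.1 else odflt a.1 [pick x in X] in
  [set c : edge G * bool |
    if c.2 then (rng c.1 == letter_vertex a) && (c.1 == rep (eclass c.1))
    else src c.1 == letter_vertex a]%SET.

Lemma default_state_local a : local_state (letter_vertex a) (default_state a).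
Proof.
split.
- by case=> x [] /=; rewrite inE /=; [move=> /andP[/eqP + _]|move/eqP].
- by move=> x sx; rewrite inE /= sx.
- move=> X hX; set rep := odflt a.1 [pick x in X].
  pose r := if a.2 && (a.1 \in X) then a.1 else rep.
  have rX : r \in X.
    rewrite /r; case: ifP => [/andP[]//|_]; rewrite /rep; case: pickP => // X0.
    have /and3P[_ _ /negP[]] := sepP (letter_vertex a).
    by move: hX; rewrite (_ : X = finset.set0) //; apply/setP => x; rewrite X0 inE.
  exists r => //; rewrite inE /= (rng_sep hX rX) eqxx /=.
  by rewrite -(eclass_sep hX rX) /r /rep.
- move=> x y; rewrite !inE /= => /andP[_ /eqP ex] /andP[_ /eqP ey] exy.
  by rewrite ex ey exy.
Qed.

Lemma default_state_mem a : a \in default_state a.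
Proof.
case: a => x []; rewrite inE /= /letter_vertex /= ?eqxx //.
by rewrite mem_eclass /= eqxx.
Qed.

Lemma local_state_switch v L (X : {set edge G}) x0 :
  local_state v L -> X \in sep v -> x0 \in X ->
  local_state v [set c : edge G * bool |
    if c.2 && (eclass c.1 == X) then c.1 == x0 else c \in L]%SET.
Proof.
move=> [h1 h2 h3 h4] hX x0X; have eX := eclass_sep hX x0X; split.
- move=> [x b]; rewrite inE /=; case: ifP => [/andP[/= -> _] /eqP ->|_ /h1//].
  by rewrite /letter_vertex /= (rng_sep hX x0X).
- by move=> x sx; rewrite inE /=; exact: h2.
- move=> Y hY; have [->|YX] := eqVneq Y X.
    by exists x0 => //; rewrite inE /= -eX !eqxx.
  have [y yY yL] := h3 Y hY; exists y => //.
  by rewrite inE /= -(eclass_sep hY yY) (negbTE YX).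
- move=> x y; rewrite !inE /= => + + exy; rewrite exy.
  by case: ifP => [_ /eqP-> /eqP->//|_]; move=> xL yL; exact: h4.
Qed.

End Grow.

Section Regrow.
Variables (G : sepgraph) (Omega : dynsys G).
Hypotheses (hG : bipartite G) (hO : universal Omega).
Local Notation ltr := (letter (edge G)).
Implicit Types (a b : ltr) (h w p : seq ltr) (t : Omega).

(** Keep the tree of t except behind the node p, give p the state L, and grow the
    tree behind p by default states.  The state L has to contain the letter
    leading back to the root. *)
Lemma regrow t b p1 v L (p := b :: p1) :
  reduced p -> itinerary t p -> local_state v L -> linv b \in L ->
  exists t' : Omega,
    (forall w, (size w <= size p)%N -> itinerary t' w = itinerary t w) /\
    (forall a, itinerary t' (a :: p) = (a \in L)).
Proof.
move=> rp tp hL bL.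
pose Lset h : {set ltr} := if h == p then L
  else if suffix p h then default_state (linv (head b h))
  else [set a : edge G * bool | itinerary t (a :: h)]%SET.
have Lshort h : (size h < size p)%N -> Lset h = [set a : edge G * bool | itinerary t (a :: h)]%SET.
  move=> hp; rewrite /Lset ifN; last by apply: contraTneq hp => ->; rewrite ltnn.
  by rewrite ifN //; apply: contraL hp => /size_suffix; rewrite leqNgt.
have offp h : reduced h -> ~~ suffix p h -> grow Lset h -> itinerary t h.
  elim: h => [//|c h IH] rh nh /=; rewrite (red_id (reduced_consW rh)).
  have nh' : ~~ suffix p h.
    apply: contra nh => /suffixP[s ->]; exact: (suffix_suffix (c :: s) p).
  rewrite /Lset (negbTE nh') ifN; first by rewrite inE => /andP[].
  by apply: contraNneq nh' => ->; exact: suffix_refl.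
have [t' ht'] : exists t' : Omega, forall w, itinerary t' w = grow Lset w.
  apply: (universal_realize hG hO); apply: grow_configuration => [h rh gh|c h rh gh].
    rewrite /Lset; case: ifP => [_|_]; first by exists v.
    case: ifPn => [_|np]; first by exists (letter_vertex (linv (head b h))); exact: default_state_local.
    have [_ _ H _] := itinerary_configuration t.
    exact: H (offp h rh np gh).
  rewrite /Lset; case: eqP => [[->]//|_].
  case: ifPn => [_|np]; first exact: default_state_mem.
  have tch := offp _ rh np gh.
  have [_ H2 _ H] := itinerary_configuration t.
  by rewrite inE (H [::] c h tch) /=; exact: H2 tch.
have agree w : (size w <= size p)%N -> grow Lset w = itinerary t w.
  elim: w => [//|a w IH] hw /=; rewrite IH; last exact: ltnW.
  case tw : (itinerary t w) => /=; last first.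
    by apply/esym/negP => /(@itinerary_suffix _ _ [:: a]); rewrite tw.
  rewrite Lshort; last exact: leq_ltn_trans (size_red w) hw.
  by rewrite inE /itinerary !theta_word_cons theta_word_red.
exists t'; split=> [w hw|a]; first by rewrite ht' agree.
rewrite ht'; cbn [grow]; rewrite agree // tp (red_id rp).
by rewrite /Lset eqxx.
Qed.

(** Let g fix W pointwise.  A node p = p0 g', with g' one of g and g^-1, is a
    translate of the shorter node p0 by a period of t.  Changing the state at p
    alone keeps t in W when p is long, hence periodic, but does not change the
    state at p0; so the state at p could not be changed. *)
Lemma forced_state t (W : set Omega) g : nbhs t W -> g <> [::] ->
  (forall u, W u -> theta_word g u = Some u) ->
  exists N, forall b p1 g', g' = g \/ g' = winv g ->
    suffix g' (b :: p1) -> (N < size (b :: p1))%N ->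
    reduced (b :: p1) -> itinerary t (b :: p1) ->
    forall v L, local_state v L -> linv b \in L ->
      forall a, itinerary t (a :: b :: p1) = (a \in L).
Proof.
move=> tW g0 fixW; have [s hs] := universal_basis hG hO tW.
exists (\max_(w <- s) size w) => b p1 g' gg' /suffixP[p0 ep] hN rp tp v L hL bL a.
have [t' [agree hp]] := regrow rp tp hL bL.
have Wt' : W t'.
  apply: hs => w ws; apply: agree; apply: leq_trans (ltnW hN).
  exact: leq_bigmax_seq.
have fix' u : W u -> theta_word g' u = Some u.
  by move=> Wu; case: gg' => ->; [exact: fixW|apply: theta_word_winv; exact: fixW].
have g'0 : (0 < size g')%N.
  by case: gg' => ->; rewrite ?size_winv; case: (g) g0.
rewrite -hp ep -cat_cons /itinerary !theta_word_cat !fix' //; last exact: nbhs_singleton tW.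
apply/esym; apply: agree; rewrite ep size_cat /=; lia.
Qed.

End Regrow.

(** * Entries of a periodic axis *)

Section FarNodes.
Variables (G : sepgraph) (Omega : dynsys G).
Local Notation ltr := (letter (edge G)).
Implicit Types (a b : ltr) (w p q g : seq ltr).

Fixpoint path_word (x : nat -> edge G) m : seq ltr :=
  if m is m'.+1 then (x m, odd m') :: path_word x m' else [::].

Variables (t : Omega) (g : seq ltr) (N : nat).

(** Supplied by [forced_state]; what follows is about paths only. *)
Hypothesis forced : forall b p1 g', g' = g \/ g' = winv g ->
    suffix g' (b :: p1) -> (N < size (b :: p1))%N ->
    reduced (b :: p1) -> itinerary t (b :: p1) ->
    forall v L, local_state v L -> linv b \in L ->
      forall a, itinerary t (a :: b :: p1) = (a \in L).

(** Nodes at which the state is forced. *)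
Definition far q := (N < size q)%N /\ (suffix g q \/ suffix (winv g) q).

Lemma far_cat p q : far q -> far (p ++ q).
Proof.
move=> [Nq sq]; split; first by rewrite size_cat; lia.
by case: sq => [/suffixP[s ->]|/suffixP[s ->]]; [left|right];
  rewrite catA suffix_suffix.
Qed.

(** A member of the separation with two elements would leave a choice at the node,
    as long as it does not contain the edge through which the node is reached. *)
Lemma far_single x p (X : {set edge G}) :
  far ((x, false) :: p) -> reduced ((x, false) :: p) ->
  itinerary t ((x, false) :: p) -> X \in sep (rng x) -> X <> eclass x ->
  (#|X| < 2)%N.
Proof.
move=> [Np sp] rp tp hX Xx; rewrite ltnNge; apply/negP => /card_gt1P[x1 [x2 [x1X x2X x12]]].
have [u eu] := itineraryE tp.
have [L hL EL] : exists2 L, local_state (rng x) L &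
    forall a, itinerary t (a :: (x, false) :: p) = (a \in L).
  exists (state u); last by move=> a; exact: itinerary_cons eu.
  apply: state_local; move: eu; rewrite theta_word_cons.
  by case: (theta_word p t) => //= u0 /theta_letter_vertex[_].
have xL : (x, true) \in L.
  rewrite -EL; move: tp; rewrite /itinerary => tp.
  have := @theta_wordK _ _ _ p t tp; rewrite /linv /= => ->.
  by move: tp; rewrite theta_word_cons; case: (theta_word p t).
have [x0 x0X x0L] : exists2 x0, x0 \in X & (x0, true) \notin L.
  case: (boolP ((x1, true) \in L)) => x1L; last by exists x1.
  exists x2 => //; apply: contra x12 => x2L.
  case: hL => _ _ _ /(_ x1 x2 x1L x2L) -> //.
  by rewrite -(eclass_sep hX x1X) -(eclass_sep hX x2X).
have far' : exists2 g', g' = g \/ g' = winv g & suffix g' ((x, false) :: p).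
  by case: sp => sp; [exists g|exists (winv g)]; auto.
case: far' => g' hg' sg'.
have /= := forced hg' sg' Np rp tp (local_state_switch hL hX x0X).
rewrite /linv inE /= ifN; last by apply/eqP => /esym.
move=> /(_ xL (x0, true)); rewrite EL inE /= -(eclass_sep hX x0X) !eqxx /=.
by move=> e; rewrite e in x0L.
Qed.

(** An admissible path can be followed from a far node that is not reached through
    its first edge: each starred edge is the only element of its class, so it is
    the one chosen by t. *)
Lemma far_follow y q M (x : nat -> edge G) :
  far ((y, true) :: q) -> reduced ((y, true) :: q) -> itinerary t ((y, true) :: q) ->
  admissible M x -> src (x 1%N) = src y -> x 1%N <> y ->
  forall m, (m <= M)%N -> reduced (path_word x m ++ (y, true) :: q) /\
    itinerary t (path_word x m ++ (y, true) :: q).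
Proof.
move=> fq rq tq [adm1 adm2] s1 x1 ; elim=> [//|m IH] mM.
have {IH} [rp tp] := IH (ltnW mM).
have [u eu] := itineraryE tp.
have {tp}tp : itinerary t (path_word x m ++ (y, true) :: q) := tp.
case: (boolP (odd m)) => om.
  pose i := m./2.+1.
  have mi : m = i.*2.-1 by rewrite /i; lia.
  have [||rxi cxi] := adm1 i; [by []|lia|].
  have m0 : m = m.-1.+1 by lia.
  have evm : odd m.-1 = false by lia.
  have pe : path_word x m ++ (y, true) :: q =
      (x m, false) :: (path_word x m.-1 ++ (y, true) :: q).
    by rewrite {1}m0 /= evm -m0.
  have xm1 : x m.+1 = x i.*2 by congr x; lia.
  have xm : x m = x i.*2.-1 by rewrite -mi.
  have rx : rng (x m.+1) = rng (x m) by rewrite xm1 xm.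
  have cx : eclass (x m.+1) <> eclass (x m) by rewrite xm1 xm => /esym.
  rewrite [path_word _ _]/= om cat_cons; split.
    rewrite pe reduced_cons2 -pe rp andbT /linv /=.
    by apply/eqP => -[e]; apply: cx; rewrite e.
  rewrite (itinerary_cons _ eu).
  have uv : dvert Omega (rng (x m)) u.
    move: eu; rewrite pe theta_word_cons; case: (theta_word _ t) => //= u0.
    by move=> /theta_letter_vertex[_].
  have [_ _ choice _] := state_local uv.
  have [|z zX zu] := choice (eclass (x m.+1)); first by rewrite -rx sep_eclass.
  have : (#|eclass (x m.+1)| < 2)%N.
    apply: (@far_single (x m) (path_word x m.-1 ++ (y, true) :: q)).
    - by rewrite -pe; exact: far_cat.
    - by rewrite -pe.
    - by rewrite -pe.
    - by rewrite -rx sep_eclass.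
    - exact: cx.
  rewrite ltnNge => /negP; case: (eqVneq z (x m.+1)) => [<-//|zx] [].
  by apply/card_gt1P; exists z, (x m.+1); split => //; exact: mem_eclass.
(* the edge through which the current source vertex was reached *)
pose ym := if m is 0%N then y else x m.
have [p pe] : exists p, path_word x m ++ (y, true) :: q = (ym, true) :: p.
  rewrite /ym; case: (m) om => [|m' om] /=; first by exists q.
  by exists (path_word x m' ++ (y, true) :: q); move: om => /= /negbNE ->.
have [sm nm] : src (x m.+1) = src ym /\ x m.+1 <> ym.
  rewrite /ym; case: (posnP m) => [->//|m0].
  have [||] := adm2 m./2; [lia|lia|].
  have -> : m./2.*2 = m by lia.
  by case: (m) m0 => // m' _ ->.
rewrite [path_word _ _]/= (negbTE om) cat_cons; split.
  rewrite pe reduced_cons2 -pe rp andbT /linv /=.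
  by apply/eqP => -[e]; apply: nm; rewrite e.
rewrite (itinerary_cons _ eu).
have uv : dvert Omega (src ym) u.
  move: eu; rewrite pe theta_word_cons; case: (theta_word _ t) => //= u0.
  by move=> /theta_letter_vertex[_].
by have [_ h _ _] := state_local uv; exact: h.
Qed.

Lemma far_dead y q e k (x : nat -> edge G) :
  far ((y, true) :: q) -> reduced ((y, true) :: q) -> itinerary t ((y, true) :: q) ->
  src e = src y -> x 1%N <> y -> ~ is_entry e k x.
Proof.
move=> fq rq tq se x1 [k0 adm sx [X [hX cX nX]]].
have [rp tp] := far_follow fq rq tq adm (etrans sx se) x1 (leqnn _).
have ek : k.*2.-1 = k.*2.-2.+1 by lia.
have pe : path_word x k.*2.-1 ++ (y, true) :: q =
    (x k.*2.-1, false) :: (path_word x k.*2.-2 ++ (y, true) :: q).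
  rewrite {1}ek /= (_ : odd k.*2.-2 = false); last by lia.
  by rewrite -ek.
move: cX; rewrite leqNgt => /negP; apply.
apply: (@far_single (x k.*2.-1) (path_word x k.*2.-2 ++ (y, true) :: q)) => //.
- by rewrite -pe; exact: far_cat.
- by rewrite -pe.
- by rewrite -pe.
Qed.

End FarNodes.

(** * Topological freeness *)

Section Periodic.
Variables (G : sepgraph) (l : nat -> letter (edge G)).
Local Notation ltr := (letter (edge G)).

Fixpoint segment j n : seq ltr :=
  if n is n'.+1 then l (j + n')%N :: segment j n' else [::].

Lemma size_segment j n : size (segment j n) = n.
Proof. by elim: n => //= n ->. Qed.

Lemma segment_cat j n m : segment j (n + m)%N = segment (j + n)%N m ++ segment j n.
Proof.
elim: m => [|m IH]; first by rewrite addn0.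
by rewrite addnS /= IH addnA.
Qed.

Lemma segment_reduced j n :
  (forall i, l i != linv (l i.+1)) -> reduced (segment j n).
Proof.
move=> h; elim: n => [//|[//|n] IH].
by rewrite [segment _ _]/= reduced_cons2 addnS h.
Qed.

Variable r : nat.
Hypothesis per : forall i, l (i + r)%N = l i.

Lemma period_mul i k : l (i + k * r)%N = l i.
Proof.
elim: k => [|k IH]; first by rewrite addn0.
by rewrite mulSn (addnC r) addnA per IH.
Qed.

Lemma segment_period k n : segment (k * r)%N n = segment 0 n.
Proof. by elim: n => //= n ->; rewrite addnC period_mul. Qed.

End Periodic.

Section Freeness.
Variables (G : sepgraph) (Omega : dynsys G).
Hypotheses (hG : bipartite G) (hL : condition_L G) (hO : universal Omega).
Local Notation ltr := (letter (edge G)).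
Implicit Types (a b : ltr) (w p q g : seq ltr).

(** The axis passes through each of its vertices infinitely often in both
    directions, and arrives there through two different edges.  An entry at that
    vertex starts differently from one of them, and can be followed behind
    the corresponding far node, where no choice is left. *)
Lemma not_fixed_periodic (W : set Omega) (l : nat -> ltr) r :
  open W -> W !=set0 -> (0 < r)%N ->
  (forall i, l (i + r) = l i)%N -> (forall i, l i != linv (l i.+1)) ->
  ~ (forall u, W u -> theta_word (segment l 0 r) u = Some u).
Proof.
move=> oW [t Wt] r0 per lred fixW.
have tW : nbhs t W := open_nbhs_nbhs (conj oW Wt).
pose g := segment l 0 r.
have g0 : g <> [::] by move=> /(congr1 size); rewrite size_segment /=; lia.
have [N forced] := forced_state hG hO tW g0 fixW.
have power k : theta_word (segment l 0 (k * r)%N) t = Some t.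
  elim: k => [//|k IH]; rewrite mulSn addnC segment_cat theta_word_cat IH /=.
  by rewrite add0n segment_period // fixW.
have defined n : itinerary t (segment l 0 n).
  have e : (n * r = n + (n * r - n))%N by rewrite subnKC // leq_pmulr.
  have := power n; rewrite e segment_cat => h.
  by apply: (@itinerary_suffix _ _ (segment l (0 + n)%N (n * r - n)%N)); rewrite /itinerary h.
(* bipartiteness makes edges and inverses alternate *)
have consec i : letter_vertex (linv (l i)) = letter_vertex (l i.+1) /\
    (l i.+1).2 = ~~ (l i).2 /\
    ((l i).2 = false -> eclass (l i).1 <> eclass (l i.+1).1).
  have [u eu] := itineraryE (defined i.+1).
  have hu : l i.+1 \in state u by rewrite -(itinerary_cons _ eu); exact: (defined i.+2).
  have hu' : linv (l i) \in state u.
    rewrite -(itinerary_cons _ eu) /itinerary [segment _ _ _]/= add0n theta_wordK //.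
      exact: defined i.
    exact: (defined i.+1).
  have [v vu] := dvert_ex u.
  have [h1 _ _ h4] := state_local vu.
  have ev : letter_vertex (linv (l i)) = letter_vertex (l i.+1) by rewrite !h1.
  have ealt : (l i.+1).2 = ~~ (l i).2.
    move: ev; rewrite /letter_vertex /=.
    case: (l i).2; case: (l i.+1).2 => //= e.
      by case: (bipartite_rng_src hG (esym e)).
    by case: (bipartite_rng_src hG e).
  split=> //; split=> // li0 ec.
  have := lred i; move: ealt ec hu' hu.
  case: (l i) li0 => x b /= ->; case: (l i.+1) => y c /= -> ec hx hy.
  by have -> : x = y := h4 x y hx hy ec; rewrite eqxx.
(* the axis alternates between edges and inverses; skip the first letter if it is
   an inverse *)
pose s := nat_of_bool (l 0%N).2.
have sign i : (l i).2 = odd (i + s).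
  elim: i => [|i IH]; first by rewrite /s; case: (l 0%N).2.
  by case: (consec i) => _ [-> _]; rewrite IH addSn.
pose e k := (l (k + s).-1).1.
have lE k : (0 < k)%N -> l (k + s).-1 = (e k, ~~ odd k).
  move=> k0; rewrite /e; have := sign (k + s).-1; case: (l _) => x b /= ->.
  by congr pair; rewrite /s; case: (l 0%N).2; lia.
have adm m : admissible m e.
  split=> i i0 _.
    have [] := consec (i.*2.-1 + s).-1.
    have -> : (i.*2.-1 + s).-1.+1 = (i.*2 + s).-1 by lia.
    rewrite !lE; [|lia|lia].
    have -> : odd i.*2.-1 by lia.
    rewrite odd_double /letter_vertex /= => er [_ ec].
    by split => //; exact: ec.
  have [] := consec (i.*2 + s).-1; have := lred (i.*2 + s).-1.
  have -> : (i.*2 + s).-1.+1 = (i.*2.+1 + s).-1 by lia.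
  rewrite !lE; [|lia|lia].
  rewrite /= odd_double /letter_vertex /= => ne es _; split=> // ee.
  by move: ne; rewrite /linv /= ee eqxx.
have [i [k [x [i0 hx]]]] := infinite_path_entry hL adm.
pose j := (i.*2.-1 + s).-1.
have lj : l j = (e i.*2.-1, false) by rewrite lE; [congr pair|]; lia.
pose M := ((j + N).+2 * r)%N.
have Mbig : (j + N + r < M)%N by rewrite /M; nia.
(* if the entry starts along the axis, come from the other direction *)
case: (eqVneq (x 1%N) (e i.*2.-1)) => [x1|/eqP x1].
  pose j' := (j + N.+1 * r).-1.
  have ej' : (j + N.+1 * r = j'.+1)%N by rewrite /j'; nia.
  have lj1 : l j'.+1 = l j by rewrite -ej' period_mul.
  have [] := consec j'; rewrite lj1 lj /= => ev [en _].
  have ej : l j' = ((l j').1, true).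
    by move: en; case: (l j') => y b /= /esym/negPn ->.
  have q1 : segment l 0 (j + N.+1 * r)%N = ((l j').1, true) :: segment l 0 j'.
    by rewrite ej' /= add0n -ej.
  apply: (far_dead (t := t) (g := g) (N := N) forced (y := (l j').1)
    (q := segment l 0 j') _ _ _ _ _ hx).
  - rewrite -q1; split; first by rewrite size_segment; nia.
    left; have -> : (j + N.+1 * r = r + (j + N * r))%N by lia.
    by rewrite segment_cat; apply/suffixP; eexists.
  - by rewrite -q1; exact: segment_reduced.
  - by rewrite -q1; exact: defined.
  - by move: ev; rewrite ej /letter_vertex /=.
  - rewrite x1 => ee; have := lred j'.
    by rewrite lj1 lj ej ee /linv /= eqxx.
have [jM rM] : (j <= M)%N /\ (M - j = (M - r - j) + r)%N by lia.
have eA : segment l 0 M = segment l j (M - j) ++ segment l 0 j.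
  by rewrite -{1}(subnKC jM) segment_cat.
have q2 : winv (segment l j (M - j)) =
    (e i.*2.-1, true) :: behead (winv (segment l j (M - j))).
  have -> : (M - j = 1 + (M - j).-1)%N by lia.
  by rewrite segment_cat winv_cat /= addn0 lj /winv.
have [u eu] := itineraryE (defined j).
apply: (far_dead (t := t) (g := g) (N := N) forced (y := e i.*2.-1)
    (q := behead (winv (segment l j (M - j)))) _ _ _ _ _ hx) => //; rewrite -q2.
- split; first by rewrite size_winv size_segment; lia.
  right; rewrite rM segment_cat winv_cat.
  have -> : (j + (M - r - j) = (j + N).+1 * r)%N by rewrite /M; lia.
  rewrite segment_period // /g.
  by apply/suffixP; eexists.
- by apply: reduced_winv; exact: segment_reduced.
- have := power (j + N).+2; rewrite -/M eA theta_word_cat eu /= => h.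
  by rewrite /itinerary (theta_word_winv h).
Qed.

(** A word which is not cyclically reduced is conjugate to a shorter one. *)
Lemma topologically_free w (W : set Omega) : reduced w -> w <> [::] ->
  open W -> W !=set0 -> exists2 t, W t & theta_word w t <> Some t.
Proof.
have [n] := ubnP (size w); elim: n w W => // n IH w W wn rw w0 oW W0.
apply: contrapT => nofix.
have {nofix}fixW u : W u -> theta_word w u = Some u.
  by move=> Wu; apply: contrapT => h; apply: nofix; exists u.
case: w => [//|a w] in wn rw w0 fixW *; clear w0.
case: (boolP (last a w == linv a)) => cyc; last first.
  pose l i := nth a (rev (a :: w)) (i %% (size w).+1).
  have segE m : (m <= (size w).+1)%N -> segment l 0 m = rev (take m (rev (a :: w))).
    elim: m => [|m IHm] hm; first by rewrite take0.
    rewrite /= IHm ?(ltnW hm) // add0n (take_nth a) ?size_rev //.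
    by rewrite rev_rcons /l modn_small.
  apply: (@not_fixed_periodic W l (size w).+1) => //.
  - by move=> i; rewrite /l modnDr.
  - move=> i; rewrite /l; set k := (i %% _)%N.
    have kw : (k <= size w)%N by rewrite -ltnS ltn_mod.
    rewrite -addn1 -modnDml -/k addn1.
    case: (ltngtP k (size w)) kw => // [kw _|-> _].
      rewrite modn_small ?ltnS // !nth_rev ?ltnS //=; last exact: ltnW.
      have /(sortedP a)/(_ (size w - k.+1)%N) : sorted (fun b c : ltr => c != linv b) (a :: w) := rw.
      have -> : ((size w).+1 - k.+1 = (size w - k.+1).+1)%N by lia.
      have -> : ((size w).+1 - k.+2 = size w - k.+1)%N by lia.
      by apply; rewrite /=; lia.
    rewrite modnn !nth_rev //= subnn subn1 /= nth_last /=.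
    by apply: contraNneq cyc => {2}->; rewrite linvK.
  - by move=> u Wu; rewrite segE // -[X in take X](size_rev (a :: w)) take_size revK fixW.
case/lastP: w => [|u c] in wn rw fixW cyc *; first by move: cyc; rewrite /= eq_sym (negbTE (linv_neq a)).
move: cyc; rewrite last_rcons => /eqP ec; rewrite {c}ec in wn rw fixW.
(* conjugate by the first letter *)
pose W1 : set Omega := [set t1 | exists2 t, theta_letter a t1 = Some t & W t].
have bwd t : W t -> exists2 t1, theta_letter (linv a) t = Some t1 &
    obind (@theta_letter _ Omega a) (theta_word u t1) = Some t.
  move=> Wt; have := fixW t Wt; rewrite theta_word_cons -cats1 theta_word_cat /=.
  case: (theta_letter (linv a) t) => [t1|] //= h; by exists t1.
have [|||||t1 [t e1 Wt] nt1] := IH u W1.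
- by move: wn; rewrite /= size_rcons; lia.
- by move: rw; rewrite -cats1 => /reduced_consW/reduced_catl.
- by move=> u0; move: rw; rewrite u0 /reduced /= eqxx.
- rewrite openE => t1 [t e1 Wt].
  exact: theta_letter_near e1 (open_nbhs_nbhs (conj oW Wt)).
- case: W0 => t Wt; have [t1 e1 _] := bwd t Wt; exists t1; exists t => //.
  by rewrite -[a in LHS]linvK; exact: theta_letter_linv.
apply: nt1; have [t1' e1' e2] := bwd t Wt.
have e3 := theta_letter_linv e1; move: e1'; rewrite e3 => -[et]; rewrite -et in e2.
move: e2; case: (theta_word u t1) => [t2|] //= e2.
by have := theta_letter_linv e2; rewrite e3.
Qed.

(** Shrink W once for each group element, around a point that it moves. *)
Lemma disjoint_clopen (s : seq (freeGroup (edge G))) (W : set Omega) :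
  open W -> W !=set0 -> exists V : set Omega,
    [/\ clopen V, V !=set0, V `<=` W
      & forall (g : freeGroup (edge G)) t t', g \in s -> g != 1%g -> V t -> V t' -> theta g t <> Some t'].
Proof.
elim: s W => [|g s IH] W oW W0.
  have [t Wt] := W0.
  have [r hr] := universal_basis hG hO (open_nbhs_nbhs (conj oW Wt)).
  exists [set t' | forall w, w \in r -> itinerary t' w = itinerary t w]; split=> //.
  - have := @locally_constant_clopen Omega _ _ (fun x => x = map (itinerary t) r)
      (_ : locally_constant (fun t' => map (itinerary t') r)).
    rewrite (_ : [set t' | forall w, _] = [set t' | map (itinerary t') r = map (itinerary t) r]).
      apply=> u; have := locally_constant_seq r u (@itinerary_locally_constant _ Omega).
      by apply: filterS => u' h; apply/eq_in_map.
    by apply/seteqP; split=> t' /eq_in_map.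
  - by exists t.
have [->|g1] := eqVneq g 1%g.
  have [V [cV V0 VW hV]] := IH W oW W0; exists V; split=> // h t t'.
  by rewrite inE => /predU1P[->|]; [rewrite eqxx|exact: hV].
have g0 : fgword g <> [::] by move=> e; move/eqP: g1; apply; exact: val_inj.
have [t Wt nt] := topologically_free (fgwordP g) g0 oW W0.
have [Q oQ [Qt hQ]] : exists2 Q : set Omega, open Q &
    Q t /\ (forall u u', Q u -> Q u' -> W u /\ theta g u <> Some u').
  suff [Q nQ hQ] : exists2 Q, nbhs t Q & forall u u', Q u -> Q u' -> W u /\ theta g u <> Some u'.
    move: nQ; rewrite nbhsE => -[Q' [oQ' Q't] QQ']; exists Q' => //; split=> // u u' /QQ' + /QQ'.
    exact: hQ.
  have nW := open_nbhs_nbhs (conj oW Wt).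
  case e : (theta_word g t) nt => [t'|] nt; last first.
    exists [set u | W u /\ itinerary u g = itinerary t g].
      by apply: filterI => //; exact: itinerary_locally_constant.
    move=> u u' [Wu ug] _; split=> //; move: ug; rewrite /itinerary e /theta_word /theta.
    by case: (foldr _ _ _).
  have := @ds_hausdorff _ Omega; rewrite open_hausdorff => /(_ t t') [].
    by apply/eqP => h; apply: nt; rewrite h.
  move=> [A B] /= [/set_mem At /set_mem Bt'] [oA oB AB].
  exists [set u | [/\ W u, A u & exists2 u', theta_word g u = Some u' & B u']].
    have nA := open_nbhs_nbhs (conj oA At).
    have nB := theta_word_near e (open_nbhs_nbhs (conj oB Bt')).
    by apply: filterS3 nW nA nB.
  move=> u u' [Wu Au [u2 e2 Bu2]] [_ Au' _]; split=> //.
  rewrite /theta -/(theta_word g u) e2 => -[eu].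
  have : (A `&` B) u' by split=> //; rewrite -eu.
  by rewrite (eqP AB).
have [V [cV V0 VQ hV]] := IH Q oQ (ex_intro _ t Qt).
exists V; split=> // [u Vu|h u u']; first by case: (hQ u u) => //; exact: VQ.
rewrite inE => /predU1P[->|hs] h1 Vu Vu'; last exact: hV.
by case: (hQ u u') => //; exact: VQ.
Qed.

End Freeness.

(** * Norm estimates and quadratic equations in C*-algebras *)

Section ComplexReals.
Variable R : realType.
Local Notation K := (Cplx R).

(** Used to transfer the archimedean property to the norms, which are complex
    numbers here. *)
Lemma ge0_complex_real (x : K) : 0 <= x -> exists2 r : R, 0 <= r & x = (r%:C)%C.
Proof.
case: x => a b; rewrite lecE /= => /andP[/eqP e h].
by exists a => //; rewrite e.
Qed.

Lemma real_complex_lt (r s : R) : ((r%:C)%C < (s%:C)%C :> K) = (r < s).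
Proof. exact: ltcR. Qed.

Lemma natr_complex n : (n%:R : K) = ((n%:R)%:C)%C.
Proof. by rewrite rmorph_nat. Qed.

End ComplexReals.

Section ZmoduleFacts.
Variable V : zmodType.
Implicit Types a b c d : V.

Lemma subrD a b c d : (a + b) - (c + d) = (a - c) + (b - d).
Proof. by rewrite opprD addrACA. Qed.

Lemma subrD_opp a b : - a - - b = - (a - b).
Proof. by rewrite opprD. Qed.

End ZmoduleFacts.

Section CStarFacts.
Variables (R : realType) (A : cstarAlgType R).
Local Notation K := (Cplx R).
Implicit Types (x y z p q h u v : A) (k : K).

Lemma cmul0l x : 0 ** x = 0.
Proof. by have := cmulZl 0 (0 : A) x; rewrite !scale0r. Qed.

Lemma cmul0r x : x ** 0 = 0.
Proof. by have := cmulZr 0 x (0 : A); rewrite !scale0r. Qed.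

Lemma cmulNl x y : (- x) ** y = - (x ** y).
Proof. by rewrite -(scaleN1r x) cmulZl scaleN1r. Qed.

Lemma cmulNr x y : x ** (- y) = - (x ** y).
Proof. by rewrite -(scaleN1r y) cmulZr scaleN1r. Qed.

Lemma cmulBl x y z : (x - y) ** z = x ** z - y ** z.
Proof. by rewrite cmulDl cmulNl. Qed.

Lemma cmulBr x y z : x ** (y - z) = x ** y - x ** z.
Proof. by rewrite cmulDr cmulNr. Qed.

Lemma star0 : star (0 : A) = 0.
Proof. by have := starZ 0 (0 : A); rewrite rmorph0 !scale0r. Qed.

Lemma starN x : star (- x) = - star x.
Proof. by rewrite -(scaleN1r x) starZ rmorphN rmorph1 scaleN1r. Qed.

Lemma starB x y : star (x - y) = star x - star y.
Proof. by rewrite starD starN. Qed.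

Lemma cmul_suml I (r : seq I) (F : I -> A) y :
  (\sum_(i <- r) F i) ** y = \sum_(i <- r) F i ** y.
Proof. by apply: (big_morph (fun x => x ** y)) => [x z|]; rewrite ?cmulDl ?cmul0l. Qed.

Lemma cmul_sumr I (r : seq I) (F : I -> A) x :
  x ** (\sum_(i <- r) F i) = \sum_(i <- r) x ** F i.
Proof. by apply: (big_morph (fun y => x ** y)) => [y z|]; rewrite ?cmulDr ?cmul0r. Qed.

Lemma star_sum I (r : seq I) (F : I -> A) :
  star (\sum_(i <- r) F i) = \sum_(i <- r) star (F i).
Proof. by apply: (big_morph (@star R A)) => [y z|]; rewrite ?starD ?star0. Qed.

Lemma norm_star x : `|star x| = `|x|.
Proof.
suff H z : `|z| <= `|star z|.
  by apply/eqP; rewrite eq_le H andbT -{2}(starK x) H.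
have [->|z0] := eqVneq z 0; first by rewrite star0.
have nz : 0 < `|z| by rewrite normr_gt0.
by rewrite -(ler_pM2r nz) -expr2 -cnorm_star cnormM.
Qed.

Lemma star_cmul_eq0 x : star x ** x = 0 -> x = 0.
Proof.
move=> e; apply/eqP; rewrite -normr_eq0 -sqrf_eq0 -cnorm_star e normr0.
exact: eqxx.
Qed.

Lemma positive_star (c : A) : positive c -> star c = c.
Proof. by move=> [y ->]; rewrite starM starK. Qed.

Lemma projection_norm p : projection p -> `|p| <= 1.
Proof.
move=> [sp pp]; have [->|p0] := eqVneq p 0; first by rewrite normr0 ler01.
have np : 0 < `|p| by rewrite normr_gt0.
by rewrite -(ler_pM2r np) mul1r -expr2 -cnorm_star sp pp.
Qed.

(** The C*-identity applied to v - v q gives v q = v. *)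
Lemma partial_isometry_range v q : star v ** v = q -> projection q ->
  projection (v ** star v).
Proof.
move=> vv [sq qq].
have vq : v ** q = v.
  apply/eqP; rewrite eq_sym -subr_eq0; apply/eqP/star_cmul_eq0.
  have e1 : star v ** (v ** q) = q by rewrite cmulA vv qq.
  have e2 : q ** star v ** v = q by rewrite -cmulA vv qq.
  have e3 : q ** star v ** (v ** q) = q by rewrite -cmulA e1 qq.
  by rewrite starB starM sq cmulBl !cmulBr vv e1 e2 e3 !subrr.
split; first by rewrite starM starK.
by rewrite cmulA -[v ** star v ** v]cmulA vv vq.
Qed.

(** Banach's fixed point theorem for complex normed algebras. *)
Lemma contraction_fixpoint (U : set A) (T : A -> A) :
  closed U -> U 0 -> (forall u, U u -> U (T u)) ->
  (forall u v, U u -> U v -> `|T u - T v| <= 2^-1 * `|u - v|) ->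
  exists2 p, U p & p = T p.
Proof.
move=> cU U0 UT lip.
pose y n := iter n T 0; pose C := `|y 1%N - y 0%N|.
have Uy n : U (y n) by elim: n => //= n; exact: UT.
have step n : `|y n.+1 - y n| <= 2^-1 ^+ n * C.
  elim: n => [|n IH]; first by rewrite expr0 mul1r.
  apply: le_trans (lip (y n.+1) (y n) (Uy _) (Uy _)) _.
  by rewrite exprS -mulrA ler_wpM2l // invr_ge0 ler0n.
have C0 : 0 <= C by exact: normr_ge0.
have dist n m : `|y (n + m)%N - y n| <= 2^-1 ^+ n * (2 * C) - 2^-1 ^+ (n + m) * (2 * C).
  elim: m => [|m IH]; first by rewrite addn0 !subrr normr0.
  have -> : y (n + m.+1)%N - y n = (y (n + m).+1 - y (n + m)%N) + (y (n + m)%N - y n).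
    by rewrite addrA subrK addnS.
  apply: le_trans (ler_normD _ _) _; apply: le_trans (lerD (step _) IH) _.
  rewrite addnS exprS; set X := _ ^+ (n + m); set P := _ ^+ n * _.
  by rewrite (_ : X * C + _ = P - 2^-1 * X * (2 * C)) //; field.
have half0 : 0 <= (2^-1 : K) by rewrite invr_ge0 ler0n.
have distn n m : (n <= m)%N -> `|y n - y m| <= 2^-1 ^+ n * (2 * C).
  move=> nm; rewrite distrC -(subnKC nm); apply: le_trans (dist _ _) _.
  by rewrite lerBlDr lerDl mulr_ge0 ?exprn_ge0 // mulr_ge0 // ler0n.
have cy : cauchy (y @ \oo).
  apply: cauchy_exP => e e0.
  have [n hn] : exists n, 2^-1 ^+ n * (2 * C) < e.
    have [r r0 er] := ge0_complex_real (ltW e0).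
    have [c c0 ec] := ge0_complex_real C0.
    have {}r0 : 0 < r by rewrite -real_complex_lt -er; exact: e0.
    exists (Num.bound (r^-1 * (2 * c))).
    have := @upper_nthrootP R (r^-1 * (2 * c)) _ (leqnn _).
    set N := Num.bound _ => h.
    rewrite er ec natr_complex -[X in X ^+ _]fmorphV -rmorphXn -!rmorphM /= real_complex_lt.
    by rewrite exprVn mulrC ltr_pdivrMr ?exprn_gt0 // -ltr_pdivrMl.
  exists (y n); exists n => // m /= nm; rewrite -ball_normE /=.
  exact: le_lt_trans (distn _ _ nm) hn.
have /cvg_ex[p yp] : cvg (y @ \oo) by apply/cauchy_cvgP.
have Up : U p by apply: (closed_cvg U cU) yp; exact: nearW.
exists p => //.
have yTp : y n @[n --> \oo] --> T p.
  rewrite -cvg_shiftS; apply/cvgrPdist_lt => e e0.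
  move/cvgrPdist_lt: yp => /(_ e e0); apply: filterS => n hn.
  apply: le_lt_trans (lip p (y n) Up (Uy n)) _.
  apply: le_lt_trans hn; rewrite ler_piMl //.
  by rewrite invf_le1 ?ltr0n // ler1n.
exact: (cvg_unique (@norm_hausdorff _ _) yp yTp).
Qed.

Lemma cmul_norm_le x y a b : `|x| <= a -> `|y| <= b -> `|x ** y| <= a * b.
Proof.
by move=> xa yb; apply: le_trans (cnormM _ _) _; apply: ler_pM.
Qed.

Lemma near_approx (P : set A) u (e : K) : closure P u -> 0 < e ->
  exists2 v, P v & `|u - v| < e.
Proof.
move=> cu e0; have [v [Pv uv]] := cu _ (nbhsx_ballx u e e0); exists v => //.
by move: uv; rewrite -ball_normE.
Qed.

Lemma norm_le_closed (e : K) : 0 <= e -> closed [set u : A | `|u| <= e].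
Proof.
move=> e0 u cu /=.
rewrite real_leNgt ?ger0_real ?normr_ge0 //; apply/negP => eu.
have [v /= ve uv] : exists2 v, `|v| <= e & `|u - v| < `|u| - e.
  by apply: (near_approx cu); rewrite subr_gt0.
have : `|u| < `|u|; last by rewrite ltxx.
rewrite -{1}(subrK v u); apply: le_lt_trans (ler_normD _ _) _.
by rewrite -ltrBrDr; apply: lt_le_trans uv _; rewrite lerB.
Qed.

Lemma fixpoints_closed (f : A -> A) (k : K) :
  (forall u v, `|f u - f v| <= k * `|u - v|) -> closed [set u | f u = u].
Proof.
move=> hf u cu /=; apply/eqP; rewrite -subr_eq0 -normr_eq0; apply: contraT => n0.
have pk : 0 < `|k| + 1 by rewrite ltr_wpDl.
have pn : 0 < `|f u - u| by rewrite lt_neqAle eq_sym n0 normr_ge0.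
have [v /= fv uv] : exists2 v, f v = v & `|u - v| < `|f u - u| / (`|k| + 1).
  by apply: (near_approx cu); rewrite divr_gt0.
have : `|f u - u| < `|f u - u|; last by rewrite ltxx.
rewrite -{1}(subrK (f v) (f u)) -addrA; apply: le_lt_trans (ler_normD _ _) _.
move: uv; rewrite ltr_pdivlMr // mulrDr mulr1; apply: le_lt_trans.
rewrite {2}fv [ `|v - u|]distrC lerD2r.
have h := hf u v; have k0 : 0 <= k * `|u - v| by apply: le_trans h.
apply: le_trans h _.
by rewrite -(ger0_norm k0) normrM normr_id mulrC.
Qed.

(** x is an inverse square root of q - h in the corner of q: writing x = q + u,
    the equation x (q - h) x = q reads 2 u = x h x - u u, and the right hand
    side is contracting for small u. *)
Lemma corner_inverse_sqrt q h : projection q -> star h = h -> q ** h = h ->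
  h ** q = h -> `|h| <= 8^-1 -> exists x, star x = x /\ x ** (q - h) ** x = q.
Proof.
move=> [sq qq] sh qh hq h8.
pose T u : A := 2^-1 *: (h + u ** h + h ** u + u ** h ** u - u ** u).
pose U := [set u : A | star u = u] `&` ([set u | q ** u = u] `&`
  ([set u | u ** q = u] `&` [set u | `|u| <= 4^-1])).
have [|||u v Uu Uv|u [/= su [/= qu [/= uq _]]] eu] := @contraction_fixpoint U T.
- apply: closedI.
    by apply: (@fixpoints_closed _ 1) => u v; rewrite -starB norm_star mul1r.
  apply: closedI; first by apply: (@fixpoints_closed _ `|q|) => u v; rewrite -cmulBr cnormM.
  apply: closedI; first by apply: (@fixpoints_closed _ `|q|) => u v; rewrite -cmulBl mulrC cnormM.
  by apply: norm_le_closed; rewrite invr_ge0 ler0n.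
- by split; [|split; [|split]]; rewrite /= ?star0 ?cmul0l ?cmul0r // normr0 invr_ge0 ler0n.
- move=> u [/= su [/= qu [/= uq nu]]]; split; [|split; [|split]]; rewrite /= /T.
  + rewrite starZ !(starB, starD, starM) su sh fmorphV rmorph_nat !cmulA.
    by rewrite [h + _ + _]addrAC.
  + by rewrite cmulZr cmulBr !cmulDr !cmulA qu qh.
  + by rewrite cmulZl cmulBl !cmulDl -!cmulA uq hq.
  + rewrite normrZ ger0_norm ?invr_ge0 ?ler0n //.
    have : `|h + u ** h + h ** u + u ** h ** u - u ** u| <=
        8^-1 + 4^-1 * 8^-1 + 8^-1 * 4^-1 + 4^-1 * 8^-1 * 4^-1 + 4^-1 * 4^-1.
      apply: le_trans (ler_normB _ _) _; apply: lerD; last exact: cmul_norm_le.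
      apply: le_trans (ler_normD _ _) _; apply: lerD; last by do 2?apply: cmul_norm_le.
      apply: le_trans (ler_normD _ _) _; apply: lerD; last exact: cmul_norm_le.
      by apply: le_trans (ler_normD _ _) _; apply: lerD => //; exact: cmul_norm_le.
    move=> /(ler_wpM2l (_ : 0 <= 2^-1 :> K)) => h1; apply: le_trans (h1 _) _.
      by rewrite invr_ge0 ler0n.
    rewrite -subr_ge0 (_ : _ - _ = 31%:R / 256%:R :> K); last by field.
    by rewrite divr_ge0 ?ler0n.
- move: Uu Uv => [_ [_ [_ /= nu]]] [_ [_ [_ /= nv]]]; rewrite /T -scalerBr normrZ.
  rewrite ger0_norm ?invr_ge0 ?ler0n // ler_wpM2l ?invr_ge0 ?ler0n //.
  have -> : h + u ** h + h ** u + u ** h ** u - u ** u -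
      (h + v ** h + h ** v + v ** h ** v - v ** v) =
    ((u - v) ** h + h ** (u - v) + ((u - v) ** h ** u + v ** h ** (u - v))) -
    ((u - v) ** u + v ** (u - v)).
    rewrite !cmulBr !cmulBl !subrKA.
    by rewrite ![in LHS]subrD subrr add0r [- _ - - _]subrD_opp.
  have d0 : 0 <= `|u - v| by [].
  have : `|((u - v) ** h + h ** (u - v) + ((u - v) ** h ** u + v ** h ** (u - v))) -
      ((u - v) ** u + v ** (u - v))| <=
      `|u - v| * 8^-1 + 8^-1 * `|u - v| +
      (`|u - v| * 8^-1 * 4^-1 + 4^-1 * 8^-1 * `|u - v|) +
      (`|u - v| * 4^-1 + 4^-1 * `|u - v|).
    apply: le_trans (ler_normB _ _) _; apply: lerD; last first.
      by apply: le_trans (ler_normD _ _) _; apply: lerD; exact: cmul_norm_le.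
    apply: le_trans (ler_normD _ _) _; apply: lerD;
      by apply: le_trans (ler_normD _ _) _; apply: lerD; do 2?apply: cmul_norm_le.
  move=> /le_trans; apply; rewrite -subr_ge0.
  rewrite (_ : _ - _ = `|u - v| * (3%:R / 16%:R)); last by field.
  by rewrite mulr_ge0 // divr_ge0 ?ler0n.
exists (q + u); split; first by rewrite starD sq su.
have {}eu : u + u = h + u ** h + h ** u + u ** h ** u - u ** u.
  by rewrite -mulr2n -scaler_nat {1}eu /T scalerA mulfV ?scale1r // pnatr_eq0.
have -> : (q + u) ** (q - h) = (q + u) - (h + u ** h).
  by rewrite cmulBr !cmulDl qq uq qh.
have uhq : u ** h ** q = u ** h by rewrite -cmulA hq.
have es : h + u ** h + h ** u + u ** h ** u = u + u + u ** u by rewrite eu subrK.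
rewrite cmulBl !cmulDr !cmulDl qq uq hq qu uhq [h + _ + (_ + _)]addrA es.
rewrite (_ : _ + _ + (_ + _) = q + (u + u + u ** u)) ?addrK //.
by rewrite !addrA.
Qed.

(** 1 - y is a square root of 1 - h; it is the fixed point of the contraction
    y |-> (h + y y) / 2.  The conclusion avoids the unit, which A may lack. *)
Lemma one_sub_sqrt h : star h = h -> `|h| <= 4^-1 ->
  exists y, star y = y /\ y + y - y ** y = h.
Proof.
move=> sh h4; pose T u : A := 2^-1 *: (h + u ** u).
pose U := [set u : A | star u = u] `&` [set u | `|u| <= 2^-1].
have i0 n : 0 <= (n%:R^-1 : K) by rewrite invr_ge0 ler0n.
have [|||u v [_ /= nu] [_ /= nv]|y [/= sy _] ey] := @contraction_fixpoint U T.
- apply: closedI; last exact: norm_le_closed.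
  by apply: (@fixpoints_closed _ 1) => u v; rewrite -starB norm_star mul1r.
- by split; rewrite /= ?star0 // normr0.
- move=> u [/= su nu]; split; rewrite /= /T.
    by rewrite starZ starD starM su sh fmorphV rmorph_nat.
  rewrite normrZ ger0_norm // -[leRHS]mulr1 ler_wpM2l //.
  apply: le_trans (ler_normD _ _) _; apply: le_trans (lerD h4 (cmul_norm_le nu nu)) _.
  rewrite -subr_ge0 (_ : _ - _ = 2^-1); last by field.
  exact: i0.
- rewrite /T -scalerBr normrZ ger0_norm // ler_wpM2l //.
  rewrite subrD subrr add0r.
  have -> : u ** u - v ** v = (u - v) ** u + v ** (u - v).
    by rewrite cmulBl cmulBr subrKA.
  apply: le_trans (ler_normD _ _) _.
  have d := lexx `|u - v|.
  apply: le_trans (lerD (cmul_norm_le d nu) (cmul_norm_le nv d)) _.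
  by rewrite le_eqVlt; apply/orP; left; apply/eqP; field.
exists y; split=> //.
have -> : y + y = h + y ** y by rewrite -mulr2n -scaler_nat {1}ey /T scalerA mulfV ?scale1r // pnatr_eq0.
by rewrite addrK.
Qed.

(** For r large, r b b^* - (b x) (b x)^* = r b (1 - h) b^* with h = x x^* / r small, and
    1 - h has a square root; so (b x) (b x)^* is dominated by r b b^*. *)
Lemma hereditary_conj (B : set A) b x : cstar_subalgebra B -> hereditary B ->
  B b -> B (b ** x ** star (b ** x)).
Proof.
move=> [_ B0 Blin Bmul Bstar] hB Bb.
pose r : K := 4%:R * (`|x| * `|x|) + 1.
have r0 : 0 < r by rewrite ltr_wpDl // mulr_ge0 ?mulr_ge0.
pose h := r^-1 *: (x ** star x).
have rr : r^* = r by apply/CrealP; exact: gtr0_real.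
have sh : star h = h by rewrite starZ starM starK fmorphV /= rr.
have nh : `|h| <= 4^-1.
  rewrite normrZ gtr0_norm ?invr_gt0 // mulrC ler_pdivrMr //.
  have := cnormM x (star x); rewrite norm_star => /le_trans; apply.
  by rewrite /r mulrDr mulr1 mulKf ?pnatr_eq0 // lerDl invr_ge0 ler0n.
have [y [sy ey]] := one_sub_sqrt sh nh.
apply: (hB _ (r *: (b ** star b))).
- by rewrite -[_ *: _]addr0; apply: Blin => //; apply: Bmul => //; exact: Bstar.
- by exists (star (b ** x)); rewrite starK.
exists ((sqrtC r) *: star (b - b ** y)).
have sr : (sqrtC r)^* = sqrtC r.
  by apply/CrealP/ger0_real; rewrite sqrtC_ge0 ltW.
rewrite starZ sr starK cmulZl cmulZr scalerA -expr2 sqrtCK.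
rewrite starB !starM sy cmulBl !cmulBr.
have -> : b ** x ** (star x ** star b) = r *: (b ** h ** star b).
  rewrite /h cmulZr cmulZl scalerA divff ?gt_eqF // scale1r.
  by rewrite !cmulA.
rewrite -scalerBr; congr (_ *: _).
rewrite -ey !(cmulBr, cmulDr, cmulBl, cmulDl) !cmulA.
by rewrite -[X in _ - X]addrA opprD addrA.
Qed.

End CStarFacts.

(** * Continuous complex functions *)

Section ComplexFunctions.
Variables (R : realType) (T : topologicalType).
Local Notation K := (Cplx R).
Implicit Types a b : T -> K.

Lemma locally_constant_continuous a : locally_constant a -> continuous a.
Proof. by move=> ha t; apply: cvg_near_cst; exact: ha. Qed.

Lemma continuous_conj a : continuous a -> continuous (fun t => (a t)^*).
Proof.
move=> ca t; apply/cvgrPdist_lt => e e0.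
move/cvgrPdist_lt: (ca t) => /(_ e e0); apply: filterS => t'.
by rewrite -rmorphB /= norm_conjC.
Qed.

(** |sqrt x - sqrt y|^2 <= |x - y| for x, y >= 0. *)
Lemma continuous_sqrtC a : (forall t, 0 <= a t) -> continuous a ->
  continuous (fun t => sqrtC (a t)).
Proof.
move=> a0 ca t; apply/cvgrPdist_lt => e e0.
move/cvgrPdist_lt: (ca t) => /(_ (e ^+ 2)); rewrite exprn_gt0 // => /(_ isT).
apply: filterS => t'; set x := a t; set y := a t'.
have H x' y' : 0 <= y' -> y' <= x' -> `|sqrtC x' - sqrtC y'| ^+ 2 <= `|x' - y'|.
  move=> y0 yx; have x0 := le_trans y0 yx.
  rewrite !ger0_norm ?subr_ge0 ?ler_sqrtC //.
  rewrite -[in leRHS](sqrtCK x') -[in leRHS](sqrtCK y') subr_sqr expr2.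
  by rewrite ler_wpM2l ?subr_ge0 ?ler_sqrtC // lerD2l (@le_trans _ _ 0) ?oppr_le0 ?sqrtC_ge0.
have {}H : `|sqrtC x - sqrtC y| ^+ 2 <= `|x - y|.
  have /orP[xy|yx] := real_leVge (ger0_real (a0 t)) (ger0_real (a0 t')).
    by rewrite [ `|x - y|]distrC [ `|sqrtC x - _|]distrC; exact: H (a0 t) xy.
  exact: H (a0 t') yx.
move=> /(le_lt_trans H); rewrite ltr_pXn2r ?nnegrE ?normr_ge0 //.
exact: ltW.
Qed.

Definition char_fun (V : set T) : T -> K := fun t => if `[< V t >] then 1 else 0.

Lemma char_fun_continuous V : clopen V -> continuous (char_fun V).
Proof.
move=> cV; apply: locally_constant_continuous.
exact: (locally_constant_comp (fun b : bool => if b then 1 else 0 : K)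
  (clopen_locally_constant cV)).
Qed.

End ComplexFunctions.

(** * The crossed product *)

Section Crossed.
Variables (R : realType) (G : sepgraph) (Omega : dynsys G).
Variables (A : cstarAlgType R).
Variable (delta : freeGroup (edge G) -> (Omega -> Cplx R) -> A).
Hypothesis hA : is_reduced_crossed_product delta.
Local Notation K := (Cplx R).
Local Notation F := (freeGroup (edge G)).
Implicit Types (g h : F) (a b : Omega -> K) (t : Omega).

Lemma theta1 t : theta (1%g : F) t = Some t.
Proof. by []. Qed.

Lemma theta_inv g t t' : theta g t = Some t' -> theta g^-1%g t' = Some t.
Proof. exact: theta_word_winv. Qed.

Lemma theta_mul g h t t1 t2 : theta h t = Some t1 -> theta g t1 = Some t2 ->
  theta (g * h)%g t = Some t2.
Proof.
move=> e1 e2.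
have e : theta_word (fgword g ++ fgword h) t = Some t2.
  by rewrite theta_word_cat [theta_word h t]e1.
have := @theta_word_red _ _ (fgword g ++ fgword h) t; rewrite e => /(_ isT) <-.
by rewrite /red /lmul foldr_cat -!/(lmul _ _) lmulw1 // fgwordP.
Qed.

Lemma Dset1 a : Dset 1%g a <-> continuous a.
Proof.
split=> [[]//|ca]; split=> // t nt; exfalso; apply: nt.
by exists t; rewrite theta1.
Qed.

Lemma Dset_continuous g a : Dset g a -> continuous a.
Proof. by case. Qed.

Lemma alpha_continuous g a : continuous a -> continuous (alpha g a).
Proof.
move=> ca t; case e: (theta g^-1%g t) => [t'|].
  have eW : alpha g a t = a t' by rewrite /alpha e.
  rewrite /continuous_at eW => W aW.
  have tW : nbhs t' [set u | W (a u)] := ca t' W aW.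
  have near_t : \forall u \near t, W (alpha g a u).
    apply: filterS (theta_word_near e tW) => u [u' eu Wu].
    by rewrite /alpha (eu : theta g^-1%g u = _).
  exact: near_t.
apply: cvg_near_cst; apply: filterS (itinerary_locally_constant g^-1%g t) => u.
rewrite (_ : itinerary u _ = isSome (theta g^-1%g u)) //.
rewrite (_ : itinerary t _ = isSome (theta g^-1%g t)) // /alpha e.
by case: (theta g^-1%g u).
Qed.

Lemma alpha_Dset g a : continuous a -> Dset g (alpha g a).
Proof.
move=> ca; split=> [|t nt]; first exact: alpha_continuous.
rewrite /alpha; case e: (theta _ t) => [t'|//]; exfalso; apply: nt.
by exists t'; have := theta_inv e; rewrite invgK.
Qed.

Lemma alpha1 a : alpha 1%g a = a.
Proof. by apply/funext => t; rewrite /alpha invg1 theta1. Qed.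

Lemma Dset_zero g : Dset g (fun _ : Omega => 0 : K).
Proof. by split=> // t; exact: cvg_cst. Qed.

Lemma delta1_lin (k : K) a b : continuous a -> continuous b ->
  delta 1%g (fun t => k * a t + b t) = k *: delta 1%g a + delta 1%g b.
Proof. by move=> /Dset1 ca /Dset1 cb; rewrite -(rcp_linear hA). Qed.

Lemma delta_0 g : delta g (fun=> 0) = 0.
Proof.
have D0 := Dset_zero g; have := rcp_linear hA (-1) D0 D0; rewrite scaleN1r addNr => <-.
by congr delta; apply/funext => t /=; rewrite scaler0 addr0.
Qed.

Lemma delta1D a b : continuous a -> continuous b ->
  delta 1%g (fun t => a t + b t) = delta 1%g a + delta 1%g b.
Proof.
move=> ca cb; have := delta1_lin 1 ca cb; rewrite scale1r => <-.
by congr delta; apply/funext => t; rewrite mul1r.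
Qed.

Lemma delta1Z (k : K) a : continuous a ->
  delta 1%g (fun t => k * a t) = k *: delta 1%g a.
Proof.
move=> ca; have [c0 _] := Dset_zero 1%g.
have := delta1_lin k ca c0; rewrite delta_0 addr0 => <-.
by congr delta; apply/funext => t; rewrite addr0.
Qed.

Lemma delta1M a b : continuous a -> continuous b ->
  delta 1%g a ** delta 1%g b = delta 1%g (fun t => a t * b t).
Proof.
by move=> /Dset1 ca /Dset1 cb; rewrite (rcp_mul hA) // mulg1 invg1 !alpha1.
Qed.

Lemma delta1_star a : continuous a ->
  star (delta 1%g a) = delta 1%g (fun t => (a t)^*).
Proof. by move=> /Dset1 ca; rewrite (rcp_star hA) // invg1 alpha1. Qed.

Lemma delta1_sum I (s : seq I) (f : I -> Omega -> K) :
  (forall i, continuous (f i)) ->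
  continuous (fun t => \sum_(i <- s) f i t) /\
  \sum_(i <- s) delta 1%g (f i) = delta 1%g (fun t => \sum_(i <- s) f i t).
Proof.
move=> cf; elim: s => [|i s [c IH]].
  split; last first.
    by rewrite big_nil; under eq_fun do rewrite big_nil; rewrite delta_0.
  by under eq_fun do rewrite big_nil; move=> t; exact: cvg_cst.
under eq_fun do rewrite big_cons; split; first by move=> t; apply: cvgD; [exact: cf|exact: c].
rewrite big_cons IH; apply/esym; exact: delta1D (cf i) c.
Qed.

Lemma delta1_inj a : continuous a -> delta 1%g a = 0 -> a = fun=> 0.
Proof.
move=> ca; pose f g : Omega -> K := if g == 1%g then a else fun=> 0.
have fD g : Dset g (f g).
  by rewrite /f; case: eqP => [->|_]; [exact/Dset1|exact: Dset_zero].
have := @rcp_inj _ _ _ _ _ hA [:: 1%g] f isT fD.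
rewrite big_seq1 /f eqxx => H /H /(_ 1%g); rewrite inE eqxx; exact.
Qed.

Lemma delta1_char_projection V : clopen V -> projection (delta 1%g (char_fun R V)).
Proof.
move=> clV; have cV : continuous (char_fun R V) := char_fun_continuous clV.
split.
  rewrite (delta1_star cV); congr delta; apply/funext => t.
  by rewrite /char_fun; case: asboolP; rewrite ?rmorph1 ?rmorph0.
rewrite (delta1M cV cV); congr delta; apply/funext => t.
by rewrite /char_fun; case: asboolP; rewrite ?mulr1 ?mulr0.
Qed.

Lemma delta1_unitary_norm a : continuous a -> (forall t, (a t)^* * a t = 1) ->
  `|delta 1%g a| <= 1.
Proof.
move=> ca ua.
have e : star (delta 1%g a) ** delta 1%g a = delta 1%g (char_fun R setT).
  rewrite (delta1_star ca) (delta1M (continuous_conj ca) ca).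
  by congr delta; apply/funext => t; rewrite ua /char_fun asboolT.
have := projection_norm (delta1_char_projection clopenT).
rewrite -e cnorm_star => h.
by rewrite -(@expr_le1 _ 2) ?normr_ge0.
Qed.

(** A real function with values in [-1, 1] is the mean of the unitary
    h + i sqrt (1 - h^2) and its adjoint; this bounds its norm without
    spectral theory. *)
Lemma delta1_real_norm a : continuous a -> (forall t, a t \is Num.real) ->
  (forall t, `|a t| <= 1) -> `|delta 1%g a| <= 1.
Proof.
move=> ca ra a1.
have p t : 0 <= 1 - a t * a t.
  by rewrite subr_ge0 -expr2 -real_normK // expr_le1.
have cp : continuous (fun t => 1 - a t * a t).
  by move=> t; apply: cvgB; [exact: cvg_cst|apply: cvgM; exact: ca].
pose s t := sqrtC (1 - a t * a t).
have cs : continuous s := continuous_sqrtC p cp.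
have sC t : (s t)^* = s t by apply/CrealP/ger0_real; rewrite sqrtC_ge0.
have aC t : (a t)^* = a t by apply/CrealP.
pose u t := 'i * s t + a t.
have cu : continuous u.
  by move=> t; apply: cvgD; [apply: cvgM; [exact: cvg_cst|exact: cs]|exact: ca].
have uC t : (u t)^* = - 'i * s t + a t by rewrite /u rmorphD rmorphM /= conjCi sC aC.
have nu : `|delta 1%g u| <= 1.
  apply: delta1_unitary_norm => // t; rewrite uC /u.
  have -> : (- 'i * s t + a t) * ('i * s t + a t) = - ('i ^+ 2) * s t ^+ 2 + a t ^+ 2 by ring.
  by rewrite sqrCi opprK mul1r /s sqrtCK -expr2 subrK.
have e : delta 1%g a = 2^-1 *: (delta 1%g u + star (delta 1%g u)).
  have cuC := continuous_conj cu.
  have cD : continuous (fun t => u t + (u t)^*).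
    by move=> t; apply: cvgD; [exact: cu|exact: cuC].
  rewrite (delta1_star cu); have <- := delta1D cu cuC; have <- := delta1Z 2^-1 cD.
  by congr delta; apply/funext => t; rewrite uC /u; field.
rewrite e normrZ ger0_norm ?invr_ge0 ?ler0n //.
apply: le_trans (ler_wpM2l _ (ler_normD _ _)) _; first by rewrite invr_ge0 ler0n.
rewrite norm_star; apply: le_trans (ler_wpM2l _ (lerD nu nu)) _.
  by rewrite invr_ge0 ler0n.
by rewrite -mulr2n mulVf ?pnatr_eq0.
Qed.

Lemma delta1_norm_le a (k : K) : continuous a -> (forall t, a t \is Num.real) ->
  0 < k -> (forall t, `|a t| <= k) -> `|delta 1%g a| <= k.
Proof.
move=> ca ra k0 ak.
have : `|delta 1%g (fun t => k^-1 * a t)| <= 1.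
  apply: delta1_real_norm.
  - by move=> t; apply: cvgM; [exact: cvg_cst|exact: ca].
  - by move=> t; rewrite realM ?realV // gtr0_real.
  - by move=> t; rewrite normrM gtr0_norm ?invr_gt0 // ler_pdivrMl // mulr1.
by rewrite (delta1Z _ ca) normrZ gtr0_norm ?invr_gt0 // ler_pdivrMl // mulr1.
Qed.

(** The compression is the function 1_V (t) a (t) 1_V (theta_g^-1 t) at g, and no t lies
    in V together with theta_g^-1 t. *)
Lemma compression_offdiag g a V : clopen V -> Dset g a ->
  (forall t t', V t -> V t' -> theta g t <> Some t') ->
  delta 1%g (char_fun R V) ** delta g a ** delta 1%g (char_fun R V) = 0.
Proof.
move=> cV Da hV.
have /Dset1 DV : continuous (char_fun R V) by exact: char_fun_continuous.
rewrite (rcp_mul hA DV Da) mul1g invg1 !alpha1.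
have DVa : Dset g (char_fun R V \* a).
  split=> [t|t nt]; first by apply: cvgM; [exact: (Dset_continuous DV)|exact: (Dset_continuous Da)].
  by case: Da => _ /(_ t nt) /= ->; rewrite mulr0.
rewrite (rcp_mul hA DVa DV) mulg1; apply: etrans (delta_0 g).
congr delta; apply/funext => t.
rewrite {1}/alpha; case e: (theta _ t) => [t'|//] /=.
have e' : theta g t' = Some t by have := theta_inv e; rewrite invgK.
rewrite /alpha invgK e' /= /char_fun; case: asboolP => Vt; last by rewrite !mul0r.
by case: asboolP => Vt'; [case: (hV t' t)|rewrite mulr0].
Qed.

(** The coefficient of (a delta_g)^* (b delta_h) at g^-1 h. *)
Definition star_coef g a h b : Omega -> K :=
  alpha g^-1%g (alpha g^-1^-1%g (alpha g^-1%g (fun t => (a t)^*)) \* b).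

Lemma star_coef_mul g a h b : Dset g a -> Dset h b ->
  star (delta g a) ** delta h b = delta (g^-1 * h)%g (star_coef g a h b).
Proof.
move=> Da Db; rewrite (rcp_star hA Da) (rcp_mul hA _ Db) //.
exact: alpha_Dset (continuous_conj (Dset_continuous Da)).
Qed.

Lemma star_coef_Dset g a h b : Dset g a -> Dset h b ->
  Dset (g^-1 * h)%g (star_coef g a h b).
Proof.
move=> [ca _] [cb sb]; split=> [|t nt].
  have c1 := @alpha_continuous g^-1^-1%g _
    (@alpha_continuous g^-1%g _ (continuous_conj ca)).
  by apply: alpha_continuous => t; apply: cvgM; [exact: c1|exact: cb].
rewrite /star_coef {1}/alpha invgK; case e: (theta g t) => [t'|//] /=.
rewrite sb ?mulr0 // => -[t'' e'']; apply: nt; exists t''.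
exact: theta_mul e'' (theta_inv e).
Qed.

(** At a point in the domain of theta_g the value is |a (theta_g t)|^2. *)
Lemma star_coef_ge0 g a t : 0 <= star_coef g a g a t.
Proof.
rewrite /star_coef {1}/alpha invgK; case e: (theta g t) => [t'|//] /=.
rewrite {1}/alpha (theta_inv e) /alpha invgK e.
by rewrite mulrC mul_conjC_ge0.
Qed.

Section Diagonal.
Variables (s : seq F) (a : F -> Omega -> K).
Hypotheses (us : uniq s) (Da : forall g, Dset g (a g)).

(** The diagonal of x^* x for x the finite sum of the a_g delta_g. *)
Definition diagonal t : K := \sum_(g <- s) star_coef g (a g) g (a g) t.

Lemma diagonal_continuous : continuous diagonal.
Proof.
have [] := @delta1_sum _ s (fun g => star_coef g (a g) g (a g)) => // g.
exact: Dset_continuous (star_coef_Dset (Da g) (Da g)).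
Qed.

Lemma diagonal_ge0 t : 0 <= diagonal t.
Proof. by apply: sumr_ge0 => g _; exact: star_coef_ge0. Qed.

(** To be applied to the conditional expectation, with chi = 1, and to the
    compression by 1_V, with chi = 1_V. *)
Lemma diagonal_map (Phi : A -> A) (chi : Omega -> K) :
  (forall x y, Phi (x + y) = Phi x + Phi y) -> Phi 0 = 0 -> continuous chi ->
  (forall b, continuous b -> Phi (delta 1%g b) = delta 1%g (fun t => chi t * b t)) ->
  (forall g h b, g \in s -> h \in s -> (g^-1 * h)%g != 1%g ->
    Dset (g^-1 * h)%g b -> Phi (delta (g^-1 * h)%g b) = 0) ->
  Phi (star (\sum_(g <- s) delta g (a g)) ** (\sum_(g <- s) delta g (a g))) =
    delta 1%g (fun t => chi t * diagonal t).
Proof.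
move=> PhiD Phi0 cchi Phi1 Phig.
have Phi_sum I (r : seq I) (f : I -> A) : Phi (\sum_(i <- r) f i) = \sum_(i <- r) Phi (f i).
  exact: (big_morph Phi PhiD Phi0).
have cg g : continuous (star_coef g (a g) g (a g)).
  exact: Dset_continuous (star_coef_Dset (Da g) (Da g)).
rewrite star_sum cmul_suml Phi_sum.
have -> : (fun t => chi t * diagonal t) =
    (fun t => \sum_(g <- s) chi t * star_coef g (a g) g (a g) t).
  by apply/funext => t; rewrite /diagonal mulr_sumr.
have [|_ <-] := @delta1_sum _ s (fun g t => chi t * star_coef g (a g) g (a g) t).
  by move=> g t; apply: cvgM; [exact: cchi|exact: cg].
apply: eq_big_seq => g gs; rewrite cmul_sumr Phi_sum (bigD1_seq g) //=.
rewrite big_seq_cond big1 ?addr0; last first.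
  move=> h /andP[hs hg]; rewrite (star_coef_mul (Da g) (Da h)).
  apply: (Phig g h _ gs hs _ (star_coef_Dset (Da g) (Da h))).
  apply: contra hg => /eqP e; apply/eqP.
  by rewrite -[LHS]mul1g -(mulgV g) -mulgA e mulg1.
by rewrite (star_coef_mul (Da g) (Da g)) mulVg (Phi1 _ (cg g)).
Qed.

End Diagonal.

End Crossed.

(** * Compressing positive elements to projections *)

Section Compression.
Variables (R : realType) (G : sepgraph) (Omega : dynsys G).
Variables (A : cstarAlgType R).
Variable (delta : freeGroup (edge G) -> (Omega -> Cplx R) -> A).
Hypotheses (hG : bipartite G) (hL : condition_L G) (hO : universal Omega).
Hypothesis hA : is_reduced_crossed_product delta.
Local Notation K := (Cplx R).
Local Notation F := (freeGroup (edge G)).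
Local Notation "1_ V" := (delta 1%g (char_fun R V)) (at level 8, V at level 2, format "1_ V").

Lemma star_square_approx (P : set A) (y : A) (e : K) : closure P = setT -> 0 < e ->
  exists2 z, P z & `|star y ** y - star z ** z| <= e.
Proof.
move=> dP e0; pose d := e / (2 * `|y| + 1 + e).
have n0 : 0 <= `|y| by [].
have den0 : 0 < 2 * `|y| + 1 + e by rewrite ltr_wpDl // addr_ge0 // mulr_ge0 // ler0n.
have d0 : 0 < d by rewrite divr_gt0.
have [|z Pz yz] := near_approx (_ : closure P y) d0; first by rewrite dP.
exists z => //; have {}yz := ltW yz.
have nz : `|z| <= `|y| + d.
  by rewrite -{1}(subKr y z) ; apply: le_trans (ler_normB _ _) _; rewrite lerD2l.
have -> : star y ** y - star z ** z = star (y - z) ** y + star z ** (y - z).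
  by rewrite starB cmulBl cmulBr subrKA.
apply: le_trans (ler_normD _ _) _.
have h1 : `|star (y - z) ** y| <= d * `|y| by apply: cmul_norm_le; rewrite ?norm_star.
have h2 : `|star z ** (y - z)| <= (`|y| + d) * d by apply: cmul_norm_le; rewrite ?norm_star.
apply: le_trans (lerD h1 h2) _.
have d1 : d <= 1.
  by rewrite ler_pdivrMr // mul1r lerDr addr_ge0 // mulr_ge0 // ler0n.
have -> : d * `|y| + (`|y| + d) * d = d * (2 * `|y| + d) by ring.
apply: (@le_trans _ _ (d * (2 * `|y| + 1))); first by rewrite (ler_wpM2l (ltW d0)) // lerD2l.
by rewrite /d mulrAC ler_pdivrMr // (ler_wpM2l (ltW e0)) // lerDl ltW.
Qed.

(** The value M is taken by the diagonal f of an approximation z^* z of c, at a point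
    t0 chosen so that M is comparable to the norm of E c; V is a neighbourhood of
    t0 on which f varies little and on which z^* z compresses to its diagonal. *)
Lemma almost_scalar_compression c : positive c -> c <> 0 ->
  exists V (M : K), [/\ clopen V, V !=set0, 0 < M &
    `|1_V ** c ** 1_V - M *: 1_V| <= M * 8^-1].
Proof.
move=> [y ec] c0.
have [E [[Elin _ Enorm _ _] Efaith EE]] := rcp_expectation hA.
have ED x z : E (x + z) = E x + E z by have := Elin 1 x z; rewrite !scale1r.
have E0 : E 0 = 0 by have := ED 0 0; rewrite addr0 -{1}[E 0]addr0 => /addrI.
have mono g b : Dset g b -> E (delta g b) = if g == 1%g then delta g b else 0.
  move=> Db; pose fb g' : Omega -> K := if g' == g then b else fun=> 0.
  have Dfb g' : Dset g' (fb g').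
    by rewrite /fb; case: eqP => [->|_]; [exact: Db|exact: Dset_zero].
  have := EE [:: g] fb isT Dfb; rewrite big_seq1 inE /fb eqxx => ->.
  by rewrite eq_sym; case: eqP => [->|].
have c1 : continuous (fun _ : Omega => 1 : K) by move=> t; exact: cvg_cst.
have E1 b : continuous b -> E (delta 1%g b) = delta 1%g (fun t => 1 * b t).
  move=> cb; rewrite (mono _ _ (iffRL (Dset1 _) cb)) eqxx.
  by congr delta; apply/funext => t; rewrite mul1r.
have Ec : E c <> 0.
  by rewrite ec => /Efaith y0; apply: c0; rewrite ec y0 cmul0r.
pose eta := `|E c|.
have eta0 : 0 < eta by rewrite normr_gt0; apply/eqP.
pose eps := eta / 20%:R.
have eps0 : 0 < eps by rewrite divr_gt0 // ltr0n.
have [z [s [a [us Da ez]]] cz] := star_square_approx y (rcp_dense hA) eps0.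
have Ek g h b : g \in s -> h \in s -> (g^-1 * h)%g != 1%g ->
    Dset (g^-1 * h)%g b -> E (delta (g^-1 * h)%g b) = 0.
  by move=> _ _ k1 Db; rewrite (mono _ _ Db) (negbTE k1).
rewrite -ec in cz; pose d := star z ** z; pose f := diagonal s a.
have cf : continuous f := diagonal_continuous hA Da.
have f0 t : 0 <= f t := diagonal_ge0 s a t.
have fR t : f t \is Num.real by exact: ger0_real.
have Ed : E d = delta 1%g f.
  rewrite /d ez; apply: etrans (diagonal_map hA us Da ED E0 c1 E1 Ek) _.
  by congr delta; apply/funext => t; exact: mul1r.
have Edn : eta - eps <= `|delta 1%g f|.
  rewrite lerBlDl -Ed /eta -{1}(subrK d c) ED.
  apply: le_trans (ler_normD _ _) _; rewrite lerD2r.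
  exact: le_trans (Enorm _) cz.
have [t0 ft0] : exists t0, eta - eps - eps < f t0.
  apply: contrapT => no.
  have k0 : 0 < eta - eps - eps.
    have -> : eta - eps - eps = eta * (9%:R / 10%:R) by rewrite /eps; field.
    by rewrite mulr_gt0 // divr_gt0 ?ltr0n.
  have : `|delta 1%g f| <= eta - eps - eps.
    apply: (delta1_norm_le hA) => // t; rewrite ger0_norm //.
    rewrite (real_leNgt (fR t) (gtr0_real k0)).
    by apply/negP => h; apply: no; exists t.
  move=> /(le_trans Edn); rewrite lerBrDr gerDl => /le_lt_trans/(_ eps0).
  by rewrite ltxx.
pose M := f t0.
have epsM : 18%:R * eps <= M.
  apply: ltW; apply: le_lt_trans ft0.
  by rewrite le_eqVlt; apply/orP; left; apply/eqP; rewrite /eps; field.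
have M0 : 0 < M by apply: lt_le_trans epsM; rewrite mulr_gt0 // ltr0n.
pose W := [set t | `|M - f t| < eps]^°.
have W0 : W t0 by move/cvgrPdist_lt: (cf t0) => /(_ eps eps0).
have [V [cV V0 VW hV]] := disjoint_clopen hG hL hO
  [seq (g^-1 * h)%g | g <- s, h <- s] (open_interior _) (ex_intro _ t0 W0).
have ci : continuous (char_fun R V) := char_fun_continuous cV.
exists V, M; split=> //; set q := 1_V.
have qn : `|q| <= 1 by apply: projection_norm; exact: delta1_char_projection.
have qd : q ** d ** q = delta 1%g (fun t => char_fun R V t * f t).
  have qD x x' : q ** (x + x') ** q = q ** x ** q + q ** x' ** q by rewrite cmulDr cmulDl.
  have q0 : q ** 0 ** q = 0 by rewrite cmul0r cmul0l.
  have q1 b : continuous b ->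
      q ** delta 1%g b ** q = delta 1%g (fun t => char_fun R V t * b t).
    move=> cb; have cVb : continuous (fun t => char_fun R V t * b t).
      by move=> t; apply: cvgM; [exact: ci|exact: cb].
    rewrite /q (delta1M hA ci cb) (delta1M hA cVb ci).
    congr delta; apply/funext => t; rewrite /char_fun.
    by case: asboolP => _; rewrite ?mulr1 ?mulr0 ?mul0r.
  have qk g h b : g \in s -> h \in s -> (g^-1 * h)%g != 1%g ->
      Dset (g^-1 * h)%g b -> q ** delta (g^-1 * h)%g b ** q = 0.
    move=> gs hs k1 Db; apply: (compression_offdiag hA cV Db) => t t' Vt Vt'.
    by apply: hV => //; apply/allpairsP; exists (g, h).
  rewrite /d ez.
  exact: (diagonal_map (Phi := fun x => q ** x ** q) hA us Da qD q0 ci q1 qk).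
have -> : q ** c ** q - M *: q = q ** (c - d) ** q + (q ** d ** q - M *: q).
  by rewrite cmulBr cmulBl addrA subrK.
have h1 : `|q ** (c - d) ** q| <= 1 * eps * 1 by do 2?apply: cmul_norm_le.
have cVf : continuous (fun t => char_fun R V t * f t).
  by move=> t; apply: cvgM; [exact: ci|exact: cf].
have cVfM : continuous (fun t => char_fun R V t * (f t - M)).
  by move=> t; apply: cvgM; [exact: ci|apply: cvgB; [exact: cf|exact: cvg_cst]].
have h2 : `|q ** d ** q - M *: q| <= eps.
  have -> : q ** d ** q - M *: q = delta 1%g (fun t => char_fun R V t * (f t - M)).
    rewrite qd addrC -scaleNr; apply: etrans (esym (delta1_lin hA (- M) ci cVf)) _.
    by congr delta; apply/funext => t; ring.
  apply: (delta1_norm_le hA cVfM) => [t|//|t].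
    apply: realM; last by rewrite realB // fR.
    by rewrite /char_fun; case: asboolP.
  rewrite /char_fun; case: asboolP => [/VW Wt|_]; last by rewrite mul0r normr0 ltW.
  by rewrite mul1r distrC; have /= := interior_subset Wt => /ltW.
apply: le_trans (ler_normD _ _) _; apply: le_trans (lerD h1 h2) _.
rewrite mul1r mulr1 ler_pdivlMr ?ltr0n //; apply: le_trans epsM.
rewrite -subr_ge0 (_ : _ - _ = 2 * eps); last by ring.
by rewrite mulr_ge0 ?ltW // ltr0n.
Qed.

(** M^-1 q c q is q - h with h small, so it has an inverse square root in the corner
    of q. *)
Lemma positive_to_projection c : positive c -> c <> 0 ->
  exists x V, [/\ clopen V, V !=set0 & star x ** c ** x = 1_V].
Proof.
move=> pc c0; have [V [M [cV V0 M0 hM]]] := almost_scalar_compression pc c0.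
have pq := delta1_char_projection hA cV; have [sq qq] := pq.
set q := 1_V in hM sq qq pq *.
have sc := positive_star pc.
have MR : M^* = M by apply/CrealP; exact: gtr0_real.
pose h := q - M^-1 *: (q ** c ** q).
have [||||x0 [sx0 ex0]] := @corner_inverse_sqrt _ _ q h pq.
- by rewrite /h starB starZ fmorphV /= MR !starM sq sc cmulA.
- by rewrite /h cmulBr qq cmulZr !cmulA qq.
- by rewrite /h cmulBl qq cmulZl -!cmulA qq.
- have -> : h = - (M^-1 *: (q ** c ** q - M *: q)).
    by rewrite scalerBr scalerA mulVf ?gt_eqF // scale1r opprB.
  rewrite normrN normrZ gtr0_norm ?invr_gt0 //.
  by rewrite ler_pdivrMl.
exists ((sqrtC M)^-1 *: (q ** x0)), V; split=> //.
have sM : ((sqrtC M)^-1)^* = (sqrtC M)^-1.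
  by apply/CrealP/ger0_real; rewrite invr_ge0 sqrtC_ge0 ltW.
rewrite starZ sM starM sq sx0 !cmulZl cmulZr scalerA -expr2 exprVn sqrtCK.
by apply: etrans ex0; rewrite /h subKr cmulZr cmulZl !cmulA.
Qed.

Lemma delta1_char_neq0 V : clopen V -> V !=set0 -> 1_V <> 0.
Proof.
move=> cV [t Vt] /(delta1_inj hA (char_fun_continuous cV)) /(congr1 (@^~ t)).
by rewrite /char_fun asboolT // => /eqP; rewrite oner_eq0.
Qed.

End Compression.

(* Omega is the universal (E,C)-dynamical system and A, with the embeddings
   a |-> a delta_g, is the reduced crossed product O^r(E,C). *)
Theorem theorem10p9 (R : realType) (G : sepgraph) (Omega : dynsys G)
    (A : cstarAlgType R)
    (delta : freeGroup (edge G) -> (Omega -> Cplx R) -> A)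
    (hG : bipartite G) (hL : condition_L G) (hOmega : universal Omega)
    (hA : is_reduced_crossed_product delta) :
  [/\ property_SP A,
      forall c : A, positive c -> c <> 0 ->
        exists x : A,
          [/\ projection (star x ** c ** x), star x ** c ** x <> 0
            & COmega delta (star x ** c ** x)]
    & forall I : set A, two_sided_ideal I -> nonzero_set I ->
        exists p : A,
          [/\ I p, projection p, p <> 0 & COmega delta p]].
Proof.
have compress (c : A) : positive c -> c <> 0 -> exists x : A,
    [/\ projection (star x ** c ** x), star x ** c ** x <> 0
      & COmega delta (star x ** c ** x)].
  move=> pc c0; have [x [V [cV V0 e]]] := positive_to_projection hG hL hOmega hA pc c0.
  exists x; rewrite e; split.
  - exact: (delta1_char_projection hA cV).
  - exact: (delta1_char_neq0 hA cV V0).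
  - by exists (char_fun R V) => //; exact: char_fun_continuous.
have square (b : A) : b <> 0 -> positive (star b ** b) /\ star b ** b <> 0.
  by move=> b0; split; [exists b|move/star_cmul_eq0].
split=> //.
- move=> B sB hB [b Bb /square[pb b0]]; have [x [px nx _]] := compress _ pb b0.
  exists (b ** x ** star (b ** x)); split.
  + exact: hereditary_conj.
  + apply: partial_isometry_range px; by rewrite starM !cmulA.
  + move=> e; apply: nx.
    have : star (b ** x) = 0 by apply: star_cmul_eq0; rewrite starK.
    by rewrite starM -[star x ** (_ ** _) ** x]cmulA -[star b ** b ** x]cmulA !cmulA => ->; rewrite !cmul0l.
- move=> I [_ _ hI] [b Ib /square[pb b0]]; have [x hx] := compress _ pb b0.
  exists (star x ** (star b ** b) ** x); case: hx => px nx cx; split=> //.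
  have Ibb : I (star b ** b) by case: (hI b (star b) Ib).
  have Ix : I (star x ** (star b ** b)) by case: (hI _ (star x) Ibb).
  by case: (hI _ x Ix).
Qed.
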